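(* Let $m\in\mathbb{N}$, $l,k\in\mathbb{N}_0$, let $P_k$ be a left inner spherical monogenic of degree $k$ on $\mathbb{R}^m$, and let $H_{l,m,k}$ be the generalized Clifford Hermite polynomial. Then, for all $\underline{z}\in\mathbb{C}^m$, $$\left(\mathcal{B}\left(H_{l,m,k}(\underline{x})\,e^{-\frac{|\underline{x}|^2}{4}}P_k(\underline{x})\right)\right)(\underline{z})=\underline{z}^{\,l}P_k(\underline{z}).$$
   Context: $\mathrm{C}\ell_m^{\mathbb{R}}$ and $\mathrm{C}\ell_m^{\mathbb{C}}$ denote the real and complex Clifford algebras with generators $e_1,\dots,e_m$, relations $e_ie_j+e_je_i=0$ ($i\neq j$), $e_j^2=-1$, and unit $e_0=1$. Vectors are identified with Clifford vectors: $\underline{x}=\sum_j x_je_j$ for $x\in\mathbb{R}^m$ and $\underline{z}=\sum_j z_je_j$ for $z\in\mathbb{C}^m$; $\underline{z}^{\,l}$ is the $l$-th power in $\mathrm{C}\ell_m^{\mathbb{C}}$. The Dirac operator is $D_{\underline{x}}=\sum_{j=1}^m e_j\partial_{x_j}$. A left inner spherical monogenic of degree $k$ is a $\mathrm{C}\ell_m^{\mathbb{R}}$-valued homogeneous polynomial $P_k$ of degree $k$ on $\mathbb{R}^m$ with $D_{\underline{x}}P_k=0$. $P_k(\underline{z})$ denotes the polynomial on $\mathbb{C}^m$ obtained by replacing $x_j$ by $z_j$. The generalized Clifford Hermite polynomials $H_{l,m,k}$ are given by $$H_{l,m,k}(\underline{x})P_k(\underline{x})=e^{\frac{|\underline{x}|^2}{2}}(-1)^lD_{\underline{x}}^l\left(e^{-\frac{|\underline{x}|^2}{2}}P_k(\underline{x})\right)$$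 for every left inner spherical monogenic $P_k$ of degree $k$. The Segal-Bargmann transform of $f\in L^2(\mathbb{R}^m,\mathrm{C}\ell_m^{\mathbb{R}})$ is $$(\mathcal{B}f)(\underline{z})=\frac{1}{\sqrt{2\pi}^{\,m}}\int_{\mathbb{R}^m}e^{-\frac{\underline{z}\cdot\underline{z}}{2}+\underline{x}\cdot\underline{z}-\frac{\underline{x}\cdot\underline{x}}{4}}f(\underline{x})\,d\underline{x},$$ where the dot denotes the bilinear product, $\underline{x}\cdot\underline{z}=\sum_jx_jz_j$ and $\underline{z}\cdot\underline{z}=\sum_jz_j^2$. *)

(* Defs.v *)
From HB Require Import structures.
From mathcomp Require Import all_boot all_order all_algebra.

Set Implicit Arguments.
Unset Strict Implicit.
Unset Printing Implicit Defensive.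

Import Order.TTheory GRing.Theory Num.Theory.

Local Open Scope ring_scope.

(* Clifford algebra over K on e_1, ..., e_m with e_i e_j + e_j e_i = 0 for
   i != j and e_j ^ 2 = - 1.  An element is the family of its coordinates in
   the basis (e_A), A ranging over the subsets of 'I_m, where e_A is the product
   of the e_i, i in A, in increasing order.  The alias hides the pointwise
   product that MathComp puts on finite functions. *)
Definition clifford (K : Type) (m : nat) : Type := {ffun {set 'I_m} -> K}.

Definition symdiff (T : finType) (A B : {set T}) : {set T} :=
  (A :\: B) :|: (B :\: A).

(* e_A e_B = (-1) ^ (inversions A B) e_(symdiff A B): each pair j < i costs a
   transposition, and each common index i = j costs e_i ^ 2 = - 1. *)
Definition inversions (m : nat) (A B : {set 'I_m}) : nat :=
  #|[set p : 'I_m * 'I_m | [&& p.1 \in A, p.2 \in B & (p.2 <= p.1)%N]]|.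

Section CliffordAlgebra.
Variables (K : comNzRingType) (m : nat).

HB.instance Definition _ := GRing.Lmodule.copy (clifford K m)
  {ffun {set 'I_m} -> K^o}.

Implicit Types (x y z : clifford K m) (A B C : {set 'I_m}).

Definition cl_basis A : clifford K m := [ffun B => (B == A)%:R].

(* The coordinate of x y along e_C collects the pairs with symdiff A B = C. *)
Definition cl_mul x y : clifford K m :=
  [ffun C : {set 'I_m} => \sum_(A : {set 'I_m})
     (-1) ^+ inversions A (symdiff A C) * (x A * y (symdiff A C))].

Lemma in_symdiff (A B : {set 'I_m}) i :
  (i \in symdiff A B) = (i \in A) (+) (i \in B).
Proof. by rewrite !inE; case: (i \in A); case: (i \in B). Qed.

Lemma symdiffK A : involutive (symdiff A).
Proof. by move=> B; apply/setP => i; rewrite !in_symdiff addKb. Qed.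

Lemma symdiff0 A : symdiff A set0 = A.
Proof. by apply/setP => i; rewrite in_symdiff inE addbF. Qed.

Lemma sym0diff A : symdiff set0 A = A.
Proof. by apply/setP => i; rewrite in_symdiff inE. Qed.

Lemma odd_sum (I : finType) (f : I -> nat) :
  odd (\sum_i f i)%N = \big[addb/false]_i odd (f i).
Proof. exact: (big_morph odd oddD). Qed.

Lemma odd_inversions A B : odd (inversions A B) =
  \big[addb/false]_(p : 'I_m * 'I_m)
    [&& p.1 \in A, p.2 \in B & (p.2 <= p.1)%N].
Proof.
rewrite /inversions -sum1_card big_mkcond odd_sum.
by apply: eq_bigr => p _; rewrite inE; case: ifP.
Qed.

Lemma odd_inversionsDl A B C : odd (inversions (symdiff A B) C) =
  odd (inversions A C) (+) odd (inversions B C).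
Proof.
rewrite !odd_inversions -big_split; apply: eq_bigr => p _ /=.
rewrite in_symdiff.
by case: (_ \in A); case: (_ \in B); case: (_ \in C); case: (_ <= _)%N.
Qed.

Lemma odd_inversionsDr A B C : odd (inversions A (symdiff B C)) =
  odd (inversions A B) (+) odd (inversions A C).
Proof.
rewrite !odd_inversions -big_split; apply: eq_bigr => p _ /=.
rewrite in_symdiff.
by case: (_ \in A); case: (_ \in B); case: (_ \in C); case: (_ <= _)%N.
Qed.

Lemma inversions0l A : inversions set0 A = 0%N.
Proof. by apply/eqP; rewrite cards_eq0; apply/eqP/setP => p; rewrite !inE. Qed.

Lemma inversions0r A : inversions A set0 = 0%N.
Proof.
by apply/eqP; rewrite cards_eq0; apply/eqP/setP => p; rewrite !inE andbF.
Qed.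

Lemma cl_mulA : associative cl_mul.
Proof.
move=> x y z; apply/ffunP => C; rewrite !ffunE.
transitivity (\sum_(A : {set 'I_m}) \sum_(B : {set 'I_m})
  (-1) ^+ inversions A (symdiff A C) *
  (-1) ^+ inversions B (symdiff B (symdiff A C)) *
  (x A * y B * z (symdiff B (symdiff A C)))).
  apply: eq_bigr => A _; rewrite ffunE mulr_sumr mulr_sumr.
  apply: eq_bigr => B _; rewrite -!mulrA; congr (_ * _).
  by rewrite mulrCA.
transitivity (\sum_(A : {set 'I_m}) \sum_(D : {set 'I_m})
  (-1) ^+ inversions D (symdiff D C) *
  (-1) ^+ inversions A (symdiff A D) *
  (x A * y (symdiff A D) * z (symdiff D C))); last first.
  rewrite exchange_big; apply: eq_bigr => D _ /=.
  rewrite ffunE mulr_suml mulr_sumr; apply: eq_bigr => A _.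
  by rewrite -!mulrA.
apply: eq_bigr => A _.
rewrite [RHS](reindex_inj (inv_inj (symdiffK A))).
apply: eq_bigr => B _; rewrite symdiffK.
have -> : symdiff (symdiff A B) C = symdiff B (symdiff A C).
  apply/setP => i; rewrite !in_symdiff.
  by case: (_ \in A); case: (_ \in B); case: (_ \in C).
congr (_ * _); rewrite -!exprD -signr_odd -[RHS]signr_odd; congr (_ ^+ _).
rewrite !oddD !(odd_inversionsDr, odd_inversionsDl).
case: (odd (inversions A A)) (odd (inversions A B)) (odd (inversions A C))
  (odd (inversions B A)) (odd (inversions B B)) (odd (inversions B C)).
all: by do 5![case].
Qed.

Lemma cl_mul1x : left_id (cl_basis set0) cl_mul.
Proof.
move=> x; apply/ffunP => C; rewrite ffunE (bigD1 set0)//= big1 ?addr0.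
  by rewrite ffunE eqxx inversions0l sym0diff expr0 !mul1r.
by move=> A A0; rewrite ffunE (negbTE A0) mul0r mulr0.
Qed.

Lemma cl_mulx1 : right_id (cl_basis set0) cl_mul.
Proof.
move=> x; apply/ffunP => C; rewrite ffunE (bigD1 C)//= big1 ?addr0.
  have -> : symdiff C C = set0.
    by apply/setP => i; rewrite in_symdiff addbb in_set0.
  by rewrite ffunE eqxx inversions0r expr0 mulr1 mul1r.
move=> A AC; rewrite ffunE; case: eqP => [E|]; last by rewrite !mulr0.
by case/eqP: AC; rewrite -(symdiffK A C) E symdiff0.
Qed.

Lemma cl_mulDl : left_distributive cl_mul +%R.
Proof.
move=> x y z; apply/ffunP => C; rewrite !ffunE -big_split.
by apply: eq_bigr => A _; rewrite ffunE mulrDl mulrDr.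
Qed.

Lemma cl_mulDr : right_distributive cl_mul +%R.
Proof.
move=> x y z; apply/ffunP => C; rewrite !ffunE -big_split.
by apply: eq_bigr => A _; rewrite ffunE !mulrDr.
Qed.

Lemma cl_basis0_neq0 : cl_basis set0 != 0.
Proof.
by apply/eqP => /ffunP/(_ set0)/eqP; rewrite !ffunE eqxx oner_eq0.
Qed.

HB.instance Definition _ := GRing.Zmodule_isNzRing.Build (clifford K m)
  cl_mulA cl_mul1x cl_mulx1 cl_mulDl cl_mulDr cl_basis0_neq0.

Lemma cl_scaleE (a : K) x A : (a *: x) A = a * x A.
Proof. by rewrite ffunE. Qed.

Lemma cl_scaleAl (a : K) x y : a *: (x * y) = (a *: x) * y.
Proof.
apply/ffunP => C; rewrite cl_scaleE !ffunE mulr_sumr; apply: eq_bigr => A _.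
by rewrite cl_scaleE mulrCA; congr (_ * _); rewrite mulrA.
Qed.

HB.instance Definition _ :=
  GRing.Lmodule_isLalgebra.Build K (clifford K m) cl_scaleAl.

Lemma cl_scaleAr (a : K) x y : a *: (x * y) = x * (a *: y).
Proof.
apply/ffunP => C; rewrite cl_scaleE !ffunE mulr_sumr; apply: eq_bigr => A _.
by rewrite cl_scaleE mulrCA; congr (_ * _); rewrite mulrCA.
Qed.

HB.instance Definition _ :=
  GRing.Lalgebra_isAlgebra.Build K (clifford K m) cl_scaleAr.

Definition cl_gen (j : 'I_m) : clifford K m := cl_basis [set j].

(* The vector (x_1, ..., x_m) seen as sum_j x_j e_j. *)
Definition cl_vec (x : 'rV[K]_m) : clifford K m :=
  \sum_(j < m) x 0 j *: cl_gen j.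

Lemma cl_basisM A B : cl_basis A * cl_basis B =
  (-1) ^+ inversions A B *: cl_basis (symdiff A B).
Proof.
apply/ffunP => C; rewrite cl_scaleE ffunE (bigD1 A)//= big1 ?addr0; last first.
  by move=> D DA; rewrite ffunE (negbTE DA) mul0r mulr0.
rewrite !ffunE eqxx mul1r.
have -> : (symdiff A C == B) = (C == symdiff A B).
  by rewrite -(inj_eq (inv_inj (symdiffK A))) symdiffK.
by case: eqP => [->|]; rewrite ?symdiffK ?mulr0.
Qed.

Lemma cl_gen_sqr j : cl_gen j * cl_gen j = -1.
Proof.
rewrite cl_basisM.
have -> : symdiff [set j] [set j] = set0.
  by apply/setP => i; rewrite in_symdiff addbb in_set0.
have -> : inversions [set j] [set j] = 1%N.
  rewrite /inversions -(cards1 (j, j)); apply: eq_card => -[a b].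
  rewrite !inE xpair_eqE /=.
  by case: (eqVneq a j) => // ->; case: (eqVneq b j) => // ->; rewrite leqnn.
by rewrite expr1 scaleN1r.
Qed.

Lemma cl_gen_anticomm i j : i != j ->
  cl_gen i * cl_gen j + cl_gen j * cl_gen i = 0.
Proof.
move=> ij.
have inv1 (a b : 'I_m) : inversions [set a] [set b] = (b <= a)%N.
  rewrite /inversions; have [ba|ba] := leqP b a.
    rewrite -[RHS](cards1 (a, b)); apply: eq_card => -[c d].
    rewrite !inE xpair_eqE /=.
    by case: (eqVneq c a) => // ->; case: (eqVneq d b) => // ->.
  apply/eqP; rewrite cards_eq0; apply/eqP/setP => -[c d]; rewrite !inE /=.
  case: (eqVneq c a) => // ->; case: (eqVneq d b) => // ->.
  by rewrite leqNgt ba.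
have -> : cl_gen j * cl_gen i =
  (-1) ^+ inversions [set j] [set i] *: cl_basis (symdiff [set i] [set j]).
  by rewrite cl_basisM /symdiff setUC.
rewrite cl_basisM -scalerDl !inv1.
move: ij; rewrite -val_eqE /=.
by case: ltngtP => //= _ _; rewrite ?expr1 ?expr0 ?subrr ?addNr scale0r.
Qed.

End CliffordAlgebra.

From mathcomp Require Import all_classical all_reals all_analysis.
From mathcomp Require Import complex.
(* The notations of mpoly clash with those of analysis. *)
From mathcomp.multinomials Require mpoly.
Import (canonicals, coercions) mpoly.
Import (canonicals, coercions) mpoly.Measure.Exports.
Import numFieldNormedType.Exports.

Definition cl_map (K L : Type) (m : nat) (f : K -> L) (x : clifford K m) :
  clifford L m := [ffun A => f (x A)].

Section Monogenics.
Variables (R : realType) (m : nat).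
Implicit Types (x : 'rV[R]_m) (f : 'rV[R]_m -> clifford R m).

Definition cl_partial (j : 'I_m) f x : clifford R m :=
  [ffun A => 'D_(delta_mx 0 j) (fun y => f y A : R) x].

Definition dirac_op f x : clifford R m :=
  \sum_(j < m) cl_gen R j * cl_partial j f x.

(* Clifford-valued polynomials in m real variables. *)
Definition clpoly : Type := clifford (mpoly.mpoly m R) m.

Definition clpoly_eval (P : clpoly) x : clifford R m :=
  cl_map (mpoly.meval (fun j => x 0 j)) P.

Definition clpoly_evalC (P : clpoly) (z : 'rV[R[i]]_m) : clifford R[i] m :=
  cl_map (mpoly.mmap (fun a : R => (a%:C)%C) (fun j => z 0 j)) P.

Definition inner_spherical_monogenic (k : nat) (P : clpoly) : Prop :=
  (forall A, P A \is mpoly.ishomog1 k mpoly.mdeg) /\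
  (forall x, dirac_op (clpoly_eval P) x = 0).

Definition sqnorm x : R := \sum_(j < m) x 0 j ^+ 2.

(* H is the generalized Clifford Hermite polynomial H_(l,m,k). *)
Definition clifford_hermite (l k : nat) (H : clpoly) : Prop :=
  forall P, inner_spherical_monogenic k P -> forall x,
    clpoly_eval H x * clpoly_eval P x =
    expR (sqnorm x / 2) *: ((-1) ^+ l *:
      iter l dirac_op (fun y => expR (- (sqnorm y / 2)) *: clpoly_eval P y) x).

End Monogenics.

(* Lebesgue measure on R^n, the space being presented as the n-tuples because
   these carry the product sigma-algebra. *)
Section LebesgueTuple.
Variable R : realType.
Local Notation T := (measurableTypeR R).

Definition tcons (n : nat) (p : T * n.-tuple T) : n.+1.-tuple T :=
  [tuple of p.1 :: p.2].

Lemma measurable_tcons n : measurable_fun [set: T * n.-tuple T] (@tcons n).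
Proof. exact: measurable_cons. Qed.

Section LebesgueCons.
Local Open Scope classical_set_scope.
Local Open Scope ereal_scope.
Variables (n : nat) (mu : {sigma_finite_measure set (n.-tuple T) -> \bar R}).

(* Without T1 := T, unification picks the wrong structure on R. *)
Local Notation prod := (product_measure1 (T1 := T) lebesgue_measure mu).

Definition lebesgue_cons : set (n.+1.-tuple T) -> \bar R :=
  pushforward prod (@tcons n).

Let lebesgue_cons0 : lebesgue_cons set0 = 0.
Proof. by rewrite /lebesgue_cons /pushforward preimage_set0 measure0. Qed.

Let lebesgue_cons_ge0 A : 0 <= lebesgue_cons A.
Proof. by rewrite /lebesgue_cons /pushforward measure_ge0. Qed.

Let lebesgue_cons_sigma_additive : semi_sigma_additive lebesgue_cons.
Proof.
have mtcons A : measurable A -> measurable (@tcons n @^-1` A).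
  by move=> mA; rewrite -[X in measurable X]setTI; exact: measurable_tcons.
move=> F mF tF mUF; rewrite /lebesgue_cons /pushforward preimage_bigcup.
apply: measure_semi_sigma_additive.
- by move=> i; exact: mtcons.
- apply/trivIsetP => /= i j _ _ ij; rewrite -preimage_setI.
  by move/trivIsetP : tF => /(_ _ _ _ _ ij) ->//; rewrite preimage_set0.
- by rewrite -preimage_bigcup; exact: mtcons.
Qed.

HB.instance Definition _ := isMeasure.Build _ _ _ lebesgue_cons
  lebesgue_cons0 lebesgue_cons_ge0 lebesgue_cons_sigma_additive.

Let lebesgue_cons_sigma_finite : sigma_finite setT lebesgue_cons.
Proof.
have /sigma_finiteP[F [TF ndF Foo]] := sigma_finiteT (@lebesgue_measure R).
have /sigma_finiteP[G [TG ndG Goo]] := sigma_finiteT mu.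
pose g (t : n.+1.-tuple T) : (T * n.-tuple T)%type :=
  (thead t, [tuple of behead t]).
have mg : measurable_fun setT g.
  apply: measurable_fun_pair; first exact: measurable_tnth.
  exact: measurable_behead.
have tconsK : cancel (@tcons n) g.
  by move=> [a t]; rewrite /g /tcons theadE; congr (_, _); exact: val_inj.
exists (fun k => g @^-1` (F k `*` G k)).
  apply/seteqP; split=> // t _.
  have [i _ Fi] : (\bigcup_i F i) (g t).1 by rewrite -TF.
  have [j _ Gj] : (\bigcup_i G i) (g t).2 by rewrite -TG.
  exists (maxn i j) => //; split.
    by move: (g t).1 Fi; exact/subsetPset/ndF/leq_maxl.
  by move: (g t).2 Gj; exact/subsetPset/ndG/leq_maxr.
move=> k; have [mF Fk] := Foo k; have [mG Gk] := Goo k; split.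
  by rewrite -[X in measurable X]setTI; apply: mg => //; exact: measurableX.
rewrite /lebesgue_cons /pushforward (_ : _ @^-1` _ = F k `*` G k).
  rewrite product_measure1E// lte_mul_pinfty//.
  by rewrite ge0_fin_numE.
by rewrite -comp_preimage (_ : g \o @tcons n = id)//; exact/funext/tconsK.
Qed.

HB.instance Definition _ := Measure_isSigmaFinite.Build _ _ _ lebesgue_cons
  lebesgue_cons_sigma_finite.

End LebesgueCons.

Fixpoint lebesgue_tuple (n : nat) :
    {sigma_finite_measure set (n.-tuple T) -> \bar R} :=
  if n is n'.+1 then lebesgue_cons (lebesgue_tuple n') else \d_[tuple].

End LebesgueTuple.

Section SegalBargmann.
Variables (R : realType) (m : nat).
Local Notation T := (measurableTypeR R).

Definition row_of_tuple (t : m.-tuple T) : 'rV[R]_m := \row_j tnth t j.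

(* f belongs to L^2(R^m, Cl): each of its finitely many coordinates does. *)
Definition in_L2 (f : 'rV[R]_m -> clifford R m) : Prop :=
  forall A, (fun t => f (row_of_tuple t) A : R) \in
    Lfun (lebesgue_tuple R m) 2%:E.

Definition cexp (z : R[i]) : R[i] :=
  (expR (Re z) * cos (Im z) +i* (expR (Re z) * sin (Im z)))%C.

(* Integral over R^m of a complex-valued, resp. a Clifford-valued function,
   taken coordinatewise. *)
Definition cintegral (f : 'rV[R]_m -> R[i]) : R[i] :=
  ((\int[lebesgue_tuple R m]_t Re (f (row_of_tuple t)))
   +i* (\int[lebesgue_tuple R m]_t Im (f (row_of_tuple t))))%C.

Definition clintegral (f : 'rV[R]_m -> clifford R[i] m) : clifford R[i] m :=
  [ffun A => cintegral (fun x => f x A)].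

Definition dot (K : comNzRingType) (x y : 'rV[K]_m) : K :=
  \sum_(j < m) x 0 j * y 0 j.

Definition cplx_row (x : 'rV[R]_m) : 'rV[R[i]]_m :=
  map_mx (fun a : R => (a%:C)%C) x.

Definition segal_bargmann (f : 'rV[R]_m -> clifford R m) (z : 'rV[R[i]]_m) :
    clifford R[i] m :=
  (((Num.sqrt (2 * pi) ^+ m)^-1)%:C)%C *: clintegral (fun x =>
    cexp (- (dot z z / 2) + dot (cplx_row x) z
          - dot (cplx_row x) (cplx_row x) / 4) *:
    cl_map (fun a : R => (a%:C)%C) (f x)).

End SegalBargmann.

(* Main.v *)
Require Import Defs.
From mathcomp Require Import all_boot all_order all_algebra.
From mathcomp Require Import all_classical all_reals all_analysis.
From mathcomp Require Import complex.
From mathcomp Require Import measurable_realfun ring lra.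
From mathcomp.multinomials Require mpoly.
Import (canonicals, coercions) mpoly.

(* Write (T p)(z) for the normalized integral of the polynomial p against the
   kernel exp(- z.z / 2 + x.z - x.x / 2), so that T 1 = 1.  Integration by
   parts gives T (x_j p) = z_j T p + T (d_j p).  The function transformed by B
   is e^(- |x|^2 / 4) Q with Q = (x - D)^l P_k, so its transform is T Q, and
   the recurrence turns each factor x_j - d_j into z_j, whence
   T Q = z^l T P_k.  Finally T p = p(z) for p homogeneous and harmonic: by
   Euler's identity k p = sum_j x_j d_j p, so
   k T p = sum_j z_j T (d_j p) + T (Delta p), and one concludes by induction
   on k.  The coordinates of P_k are harmonic since D^2 = - Delta. *)

Set Implicit Arguments.
Unset Strict Implicit.
Unset Printing Implicit Defensive.

Import Order.TTheory GRing.Theory Num.Theory.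
Import numFieldNormedType.Exports.

Local Open Scope ring_scope.

(** * Gaussian moments on the line *)

(** For complex z the identity T 1 = 1 is more than the total mass of a normal density, and no
    contour is shifted to obtain it. Put K = exp(- (x - z)^2 / 2) with z = a + i b. Since K depends
    on x - z only, d_b K = - i d_x K, so the integral of K has zero derivative in b, and b may be
    set to 0. In m variables the kernel is a product over the coordinates, so the recurrence for T
    is checked on monomials, where it is a relation between moments on the line. Afterwards T is
    used through four properties only: additivity, real homogeneity, T 1 = 1 and the recurrence. It
    acts on Clifford-valued polynomials coordinate by coordinate, and commutes with left
    multiplication by e_j because that operation permutes the coordinates up to sign. The Hermite
    polynomial enters through the product H P_k alone: conjugating D by e^(- |x|^2 / 2) gives - (x -
    D), and the resulting signs cancel (-1)^l. *)

Section RealIntegrable.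
Local Open Scope classical_set_scope.
Local Open Scope ring_scope.
Context d (T : measurableType d) (R : realType).
Variable mu : {measure set T -> \bar R}.
Implicit Types f g : T -> R.

Lemma integrable_EFinD f g : mu.-integrable setT (EFin \o f) ->
  mu.-integrable setT (EFin \o g) ->
  mu.-integrable setT (EFin \o (fun x => f x + g x)).
Proof. by move=> fi gi; exact: (integrableD measurableT fi gi). Qed.

Lemma integrable_EFinB f g : mu.-integrable setT (EFin \o f) ->
  mu.-integrable setT (EFin \o g) ->
  mu.-integrable setT (EFin \o (fun x => f x - g x)).
Proof. by move=> fi gi; exact: (integrableB measurableT fi gi). Qed.

Lemma integrable_EFinZl r f : mu.-integrable setT (EFin \o f) ->
  mu.-integrable setT (EFin \o (fun x => r * f x)).
Proof. by move=> fi; exact: (integrableZl measurableT r fi). Qed.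

End RealIntegrable.

(** * Domination by normal densities, and integrals of derivatives over the line *)

Section GaussianDomination.
Local Open Scope classical_set_scope.
Local Open Scope ring_scope.
Variable R : realType.
Implicit Types (a b x : R) (n : nat).
Local Notation mu := (@lebesgue_measure R).

(** Up to the factor e^(a^2 / 2), the Gaussian of mean 2a and variance 2 is e^(x^2 / 4) times the
    one on the left, and e^(x^2 / 4) absorbs any power of x. A normal density is both integrable and
    bounded, so the same bound serves integrability and decay at infinity. *)
Lemma gauss_dominated a n : exists2 C : R, 0 < C & forall x,
  `|x| ^+ n * expR (- (x - a) ^+ 2 / 2) <=
  C * normal_pdf (2 * a) (Num.sqrt 2) x.
Proof.
have s0 : Num.sqrt 2 != 0 :> R by rewrite gt_eqF// sqrtr_gt0.
(* From |x|^n <= 1 + x^(2n) and y^n / n! <= e^y at y = x^2 / 4. *)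
pose c : R := 1 + 4 ^+ n * n`!%:R.
have c0 : 0 < c by rewrite ltr_pwDl// mulr_ge0// exprn_ge0.
pose p : R := normal_peak (Num.sqrt 2).
have p0 : 0 < p by exact: normal_peak_gt0.
exists (c * expR (a ^+ 2 / 2) / p) => [|x].
  by rewrite divr_gt0// mulr_gt0// expR_gt0.
rewrite normal_pdfE// -/p mulrA divfK ?gt_eqF//.
rewrite /normal_fun sqr_sqrtr// -mulrA -expRD.
have -> : a ^+ 2 / 2 + - (x - 2 * a) ^+ 2 / (2 *+ 2) =
    x ^+ 2 / 4 + - (x - a) ^+ 2 / 2 by field.
rewrite expRD mulrA ler_wpM2r ?expR_ge0//.
have xn : `|x| ^+ n <= 1 + (x ^+ 2) ^+ n.
  rewrite -real_normK ?num_real// -exprM mulnC exprM.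
  by have := sqr_ge0 (`|x| ^+ n - 1); nra.
have x4 : 0 <= x ^+ 2 / 4 by rewrite divr_ge0// sqr_ge0.
have e1 : 1 <= expR (x ^+ 2 / 4) by rewrite -[leLHS]expR0 ler_expR.
(* The bound [expR_ge1Dxn] concerns a positive exponent, hence the separate case. *)
have [n0|n0] := eqVneq n 0%N.
  rewrite n0 expr0 (le_trans e1)// ler_peMl ?expR_ge0//.
  by rewrite lerDl mulr_ge0// exprn_ge0.
apply: (le_trans xn); rewrite mulrDl mul1r lerD//.
have e2 : (x ^+ 2 / 4) ^+ n / n`!%:R <= expR (x ^+ 2 / 4).
  have := expR_ge1Dxn n.-1 x4; rewrite prednK ?lt0n//.
  by apply: le_trans; rewrite lerDr.
suff -> : (x ^+ 2) ^+ n = 4 ^+ n * n`!%:R * ((x ^+ 2 / 4) ^+ n / n`!%:R).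
  by rewrite ler_wpM2l ?mulr_ge0 ?exprn_ge0.
rewrite mulrACA -exprMn [4 * _]mulrC divfK// mulfV ?mulr1//.
Qed.

Lemma integrable_continuous_dominated (f : R -> R) (n : nat) (a c : R) :
  continuous f ->
  (forall x, `|f x| <= c * (`|x| ^+ n * expR (- (x - a) ^+ 2 / 2))) ->
  mu.-integrable setT (EFin \o f).
Proof.
move=> cf fle; have [C C0 Cle] := gauss_dominated a n.
have mf : measurable_fun [set: R] f by exact: continuous_measurable_fun.
apply: (le_integrable measurableT _ _ (integrableZl _ (`|c| * C)
  (integrable_normal_pdf (2 * a) (Num.sqrt 2)))) => //=.
  exact/measurable_EFinP.
move=> x _.
rewrite lee_fin (le_trans (fle x))// [leRHS]ger0_norm; last first.
  by rewrite !mulr_ge0// ?normal_pdf_ge0// ltW.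
rewrite -mulrA (le_trans _ (ler_wpM2l (normr_ge0 c) (Cle x)))//.
by rewrite ler_wpM2r ?ler_norm// mulr_ge0// ?expR_ge0// exprn_ge0.
Qed.

Lemma continuous_is_derive (F f : R -> R) :
  (forall x, is_derive x 1 F (f x)) -> continuous F.
Proof.
by move=> dF x; apply/differentiable_continuous/derivable1_diffP; case: (dF x).
Qed.

(** The bound on |x| |F x| makes the boundary terms F(N) - F(-N) at most 2C / N, while dominated
    convergence, with |f| as majorant, sends the integrals over [-N, N] to the full integral. *)
Lemma Rintegral_derivative_eq0 (F f : R -> R) (C : R) :
  continuous f -> mu.-integrable setT (EFin \o f) ->
  (forall x, is_derive x 1 F (f x)) ->
  (forall x, `|x| * `|F x| <= C) ->
  \int[mu]_x f x = 0.
Proof.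
move=> cf intf dF FC.
(* With [n.+1] the interval is nondegenerate already at n = 0, and the boundary bound is a multiple
   of [harmonic n]. *)
pose E n : set R := [set` `[- n.+1%:R, n.+1%:R]].
have mE n : measurable (E n) by exact: measurable_itv.
have cF := continuous_is_derive dF.
have FTC n : (\int[mu]_x ((f \_ (E n)) x)%:E)%E =
    (F n.+1%:R - F (- n.+1%:R))%:E.
  rewrite EFinB -(@continuous_FTC2 _ f F).
  - rewrite [RHS]integral_mkcond; apply: eq_integral => x _.
    by rewrite restrict_EFin.
  - by rewrite -subr_gt0 opprK addr_gt0.
  - exact: continuous_subspaceT.
  - split => [x _||]; first by case: (dF x).
      exact/cvg_at_right_filter/cF.
    exact/cvg_at_left_filter/cF.
  - by move=> x _; rewrite derive1E; case: (dF x).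
have mf : measurable_fun [set: R] f by exact: continuous_measurable_fun.
have [|||||_ _ cvgf] := @dominated_convergence _ _ _ mu setT measurableT
    (fun n x => ((f \_ (E n)) x)%:E) (EFin \o f) (EFin \o (fun x => `|f x|)).
- move=> n; apply/measurable_EFinP; apply/(measurable_restrictT _ (mE n)).
  exact: measurable_funTS mf.
- exact/measurable_EFinP.
- apply: aeW => x _; apply: cvg_near_cst; near=> n.
  rewrite patchE mem_set//= /E /= in_itv/= -ler_norml.
  rewrite (@le_trans _ _ n%:R) ?ler_nat//; near: n; exact: nbhs_infty_ger.
- exact: integrable_norm.
- apply: aeW => x n _; rewrite /= lee_fin patchE; case: ifP => // _.
  by rewrite normr0.
have {cvgf}cvgF : (fun n => F n.+1%:R - F (- n.+1%:R)) @ \oo --> \int[mu]_x f x.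
  rewrite (_ : (fun n => _) =
    fine \o (fun n => (F n.+1%:R - F (- n.+1%:R))%:E))//.
  apply: fine_cvg; rewrite /Rintegral fineK; last exact: integrable_fin_num.
  by move: cvgf; under eq_fun do rewrite FTC.
apply/eqP; rewrite -normr_eq0; apply/eqP/(cvg_unique _ (cvg_norm cvgF)) => //.
have c0 : (fun n => 2 * C * harmonic n) @ \oo --> (0 : R).
  by rewrite -[X in _ --> X](mulr0 (2 * C)); apply: cvgMl_tmp; exact: cvg_harmonic.
apply: (squeeze_cvgr _ (cvg_cst 0) c0); apply: nearW => n /=.
rewrite normr_ge0/= /harmonic ler_pdivlMr//.
rewrite (le_trans (ler_wpM2r _ (ler_normB _ _)))// mulrDl.
have := FC n.+1%:R; have := FC (- n.+1%:R); rewrite normrN ger0_norm//.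
by nra.
Unshelve. all: by end_near.
Qed.

End GaussianDomination.

(** * Moments of the real and imaginary parts of the kernel *)

Section GaussianMoments.
Local Open Scope classical_set_scope.
Local Open Scope ring_scope.
Variable R : realType.
Implicit Types (a b x : R) (n : nat).
Local Notation mu := (@lebesgue_measure R).

(* gcos and gsin are the real and imaginary parts of gauss_kernel (a + i b). *)
Definition gcos a b x := expR ((b ^+ 2 - (x - a) ^+ 2) / 2) * cos ((x - a) * b).
Definition gsin a b x := expR ((b ^+ 2 - (x - a) ^+ 2) / 2) * sin ((x - a) * b).

(** Together with the next lemma, this is d_x K = (z - x) K split into real and imaginary parts,
    where K = gcos + i gsin and z = a + i b. *)
Lemma is_derive_gcos a b x :
  is_derive x 1 (gcos a b) (- (x - a) * gcos a b x - b * gsin a b x).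
Proof.
rewrite /gcos /gsin.
by apply: is_derive_eq; rewrite /GRing.scale/=; field.
Qed.

Lemma is_derive_gsin a b x :
  is_derive x 1 (gsin a b) (- (x - a) * gsin a b x + b * gcos a b x).
Proof.
rewrite /gcos /gsin.
by apply: is_derive_eq; rewrite /GRing.scale/=; field.
Qed.

(** Real part of d_b K = - i d_x K: the value is the x-derivative of [gsin]. The imaginary part, in
    the next lemma, is minus the x-derivative of [gcos]. *)
Lemma is_derive_gcos_param a b x :
  is_derive b 1 (fun b' => gcos a b' x) (b * gcos a b x - (x - a) * gsin a b x).
Proof.
rewrite /gcos /gsin.
by apply: is_derive_eq; rewrite /GRing.scale/=; field.
Qed.

Lemma is_derive_gsin_param a b x :
  is_derive b 1 (fun b' => gsin a b' x) (b * gsin a b x + (x - a) * gcos a b x).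
Proof.
rewrite /gcos /gsin.
by apply: is_derive_eq; rewrite /GRing.scale/=; field.
Qed.

Lemma continuous_gcos a b : continuous (gcos a b).
Proof. exact: continuous_is_derive (is_derive_gcos a b). Qed.

Lemma continuous_gsin a b : continuous (gsin a b).
Proof. exact: continuous_is_derive (is_derive_gsin a b). Qed.

Lemma gcos_le a b x :
  `|gcos a b x| <= expR (b ^+ 2 / 2) * expR (- (x - a) ^+ 2 / 2).
Proof.
rewrite /gcos normrM -expRD -mulrDl (ger0_norm (expR_ge0 _)).
by rewrite ler_piMr ?expR_ge0// ler_norml cos_geN1 cos_le1.
Qed.

Lemma gsin_le a b x :
  `|gsin a b x| <= expR (b ^+ 2 / 2) * expR (- (x - a) ^+ 2 / 2).
Proof.
rewrite /gsin normrM -expRD -mulrDl (ger0_norm (expR_ge0 _)).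
by rewrite ler_piMr ?expR_ge0// ler_norml sin_geN1 sin_le1.
Qed.

Section Weight.
Variables (a b : R) (g : R -> R).
Hypothesis cg : continuous g.
Hypothesis g_le : forall x,
  `|g x| <= expR (b ^+ 2 / 2) * expR (- (x - a) ^+ 2 / 2).

Lemma integrable_monomial n :
  mu.-integrable setT (EFin \o (fun x => x ^+ n * g x)).
Proof.
apply: (@integrable_continuous_dominated _ _ n a (expR (b ^+ 2 / 2))) => [x|x].
  by apply: cvgM; [exact: exprn_continuous|exact: cg].
by rewrite normrM normrX mulrCA ler_wpM2l// exprn_ge0.
Qed.

(** Supplies the decay hypothesis of [Rintegral_derivative_eq0]; the extra factor |x| merely raises
    the power to n + 1. *)
Lemma norm_monomial_bounded n : exists C, forall x, `|x| * `|x ^+ n * g x| <= C.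
Proof.
have [C C0 Cle] := @gauss_dominated R a n.+1.
exists (expR (b ^+ 2 / 2) * (C * normal_peak (Num.sqrt 2))) => x.
rewrite normrM normrX [leLHS]mulrA -exprS.
apply: (@le_trans _ _ (expR (b ^+ 2 / 2) *
    (`|x| ^+ n.+1 * expR (- (x - a) ^+ 2 / 2)))).
  by rewrite mulrCA ler_wpM2l// exprn_ge0.
rewrite ler_wpM2l ?expR_ge0// (le_trans (Cle x))// ler_wpM2l ?(ltW C0)//.
by apply: normal_pdf_ub; rewrite gt_eqF// sqrtr_gt0.
Qed.

End Weight.

Lemma integrable_gcos a b n :
  mu.-integrable setT (EFin \o (fun x => x ^+ n * gcos a b x)).
Proof. exact: integrable_monomial (@continuous_gcos a b) (gcos_le a b) n. Qed.

Lemma integrable_gsin a b n :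
  mu.-integrable setT (EFin \o (fun x => x ^+ n * gsin a b x)).
Proof. exact: integrable_monomial (@continuous_gsin a b) (gsin_le a b) n. Qed.

(** The derivative of x^n g integrates to 0. The pair (g, h) and the constant c cover both cases:
    ([gcos], [gsin]) with c = -b and ([gsin], [gcos]) with c = b. At n = 0 the truncated predecessor
    is harmless, its coefficient being 0. *)
Lemma moment_by_parts a b c n (g h : R -> R) :
  continuous g -> continuous h ->
  (forall x, `|g x| <= expR (b ^+ 2 / 2) * expR (- (x - a) ^+ 2 / 2)) ->
  (forall x, `|h x| <= expR (b ^+ 2 / 2) * expR (- (x - a) ^+ 2 / 2)) ->
  (forall x, is_derive x 1 g (- (x - a) * g x + c * h x)) ->
  \int[mu]_x (x ^+ n.+1 * g x) =
  n%:R * \int[mu]_x (x ^+ n.-1 * g x) + a * \int[mu]_x (x ^+ n * g x)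
  + c * \int[mu]_x (x ^+ n * h x).
Proof.
move=> cg ch gle hle dg.
have ig k := integrable_monomial cg gle k.
have ih k := integrable_monomial ch hle k.
pose f x := n%:R * (x ^+ n.-1 * g x) + a * (x ^+ n * g x) + c * (x ^+ n * h x)
  - x ^+ n.+1 * g x.
have i2 := integrable_EFinD (integrable_EFinZl n%:R (ig n.-1))
  (integrable_EFinZl a (ig n)).
have i3 := integrable_EFinD i2 (integrable_EFinZl c (ih n)).
have [C FC] := norm_monomial_bounded gle n.
have /eqP : \int[mu]_x f x = 0.
  apply: (@Rintegral_derivative_eq0 _ (fun x => x ^+ n * g x) _ C) => //.
  - move=> x; apply: cvgB; last first.
      by apply: cvgM; [exact: exprn_continuous|exact: cg].
    have cM k (u : R -> R) r : continuous u ->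
        (r * (y ^+ k * u y)) @[y --> x] --> r * (x ^+ k * u x).
      move=> cu; apply: cvgMl_tmp; apply: cvgM; [exact: exprn_continuous|exact: cu].
    by apply: cvgD; [apply: cvgD|]; exact: cM.
  - exact: integrable_EFinB.
  move=> x; have := dg x => dgx.
  have dX : is_derive x 1 (fun y : R => y ^+ n) (n%:R * x ^+ n.-1).
    apply: DeriveDef; first exact: exprn_derivable.
    by rewrite exp_derive /GRing.scale/= mulr1.
  apply: (@is_derive_eq _ _ _ _ _ _ _ _ (is_deriveM dX dgx)).
  rewrite /f /GRing.scale/=; case: (n) => [|k] /=.
    by rewrite expr0 expr1; ring.
  by rewrite !exprS -natr1; ring.
rewrite /f RintegralB//.
rewrite subr_eq0 => /eqP <-.
rewrite RintegralD//; [|exact: integrable_EFinZl].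
by rewrite RintegralD//; [rewrite !RintegralZl|exact: integrable_EFinZl..].
Qed.

Lemma moment_gcosS a b n :
  \int[mu]_x (x ^+ n.+1 * gcos a b x) =
  n%:R * \int[mu]_x (x ^+ n.-1 * gcos a b x)
  + a * \int[mu]_x (x ^+ n * gcos a b x) - b * \int[mu]_x (x ^+ n * gsin a b x).
Proof.
rewrite -mulNr; apply: (moment_by_parts n (@continuous_gcos a b)
  (@continuous_gsin a b) (gcos_le a b) (gsin_le a b)) => x.
by rewrite [- b * _]mulNr; exact: is_derive_gcos.
Qed.

Lemma moment_gsinS a b n :
  \int[mu]_x (x ^+ n.+1 * gsin a b x) =
  n%:R * \int[mu]_x (x ^+ n.-1 * gsin a b x)
  + a * \int[mu]_x (x ^+ n * gsin a b x) + b * \int[mu]_x (x ^+ n * gcos a b x).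
Proof.
exact: (moment_by_parts n (@continuous_gsin a b)
  (@continuous_gcos a b) (gsin_le a b) (gcos_le a b) (is_derive_gsin a b)).
Qed.

(** Differentiation under the integral sign. The bound on [dg] grows with b', so domination is only
    local; this suffices for the derivative to vanish at each point. *)
Lemma Rintegral_param_cst (g dg : R -> R -> R) a (b : R) :
  (forall b' x, is_derive b' 1 (g ^~ x) (dg b' x)) ->
  (forall b', mu.-integrable setT (EFin \o g b')) ->
  (forall b' x, `|dg b' x| <=
    (`|b'| + `|x| + `|a|) * (expR (b' ^+ 2 / 2) * expR (- (x - a) ^+ 2 / 2))) ->
  (forall b', \int[mu]_x dg b' x = 0) ->
  \int[mu]_x g b x = \int[mu]_x g 0 x.
Proof.
move=> dgE ig dg_le dg0.
apply: (@is_derive_0_is_cst _ (fun b' => \int[mu]_x g b' x) b 0) => c.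
(* On the neighbourhood |b'| < B of c, the factors depending on b' are bounded by their values at B,
   which gives the majorant [G]. *)
pose B := `|c| + 1.
pose G x := expR (B ^+ 2 / 2) *
  ((B + `|a|) * (`|x| ^+ 0 * expR (- (x - a) ^+ 2 / 2)) +
   `|x| ^+ 1 * expR (- (x - a) ^+ 2 / 2)).
have cI : [set` `]- B, B[] c.
  by rewrite /= in_itv/= -ltr_norml /B ltrDl.
have iG : mu.-integrable setT (EFin \o G).
  have ce n : mu.-integrable setT
      (EFin \o (fun x => `|x| ^+ n * expR (- (x - a) ^+ 2 / 2))).
    apply: (@integrable_continuous_dominated _ _ n a 1) => [x|x].
      apply: cvgM.
        apply: (cvg_comp (fun z : R => `|z|) (fun z => z ^+ n)).
          by apply: cvg_norm; exact: cvg_id.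
        exact: exprn_continuous.
      apply: (cvg_comp _ expR); last exact: continuous_expR.
      apply: cvgMr_tmp; apply: cvgN.
      apply: (cvg_comp (fun z : R => z - a) (fun z => z ^+ 2)).
        by apply: cvgB; [exact: cvg_id|exact: cvg_cst].
      exact: exprn_continuous.
    by rewrite mul1r ger0_norm// mulr_ge0 ?expR_ge0// exprn_ge0.
  by apply: (integrableZl measurableT _ (integrableD measurableT
    (integrableZl measurableT _ (ce 0%N)) (ce 1%N))).
have G0 y : 0 <= G y.
  by rewrite /G !(mulr_ge0, addr_ge0)// ?expR_ge0 ?exprn_ge0.
have der b' y : [set` `]- B, B[] b' -> [set: R] y -> derivable (g ^~ y) b' 1.
  by move=> _ _; case: (dgE b' y).
have d1E b' y : (fun b1 => g b1 y)^`()%classic b' = dg b' y.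
  by rewrite derive1E; case: (dgE b' y).
have Gub b' y : [set` `]- B, B[] b' -> [set: R] y ->
    `|partial1of2 g b' y| <= G y.
  rewrite /= in_itv/= -ltr_norml => /ltW b'B _.
  rewrite /partial1of2 d1E (le_trans (dg_le b' y))//.
  rewrite /G expr0 mul1r expr1 -mulrDl mulrCA.
  apply: ler_pM; rewrite ?expR_ge0 ?mulr_ge0 ?addr_ge0 ?expR_ge0//.
    rewrite ler_expR ler_wpM2r// -[X in X <= _]real_normK ?num_real//.
    by rewrite lerXn2r// nnegrE// addr_ge0.
  by rewrite ler_wpM2r ?expR_ge0//; lra.
have -> : 0 = \int[mu]_x ((fun b' => g b' x)^`()%classic c) :> R.
  by rewrite -(dg0 c); apply: eq_Rintegral => x _; rewrite d1E.
apply: DeriveDef.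
  exact: (derivable_under_integral measurableT cI (fun b' _ => ig b')
    der G0 iG Gub).
rewrite -derive1E.
exact: (differentiation_under_integral measurableT cI (fun b' _ => ig b')
  der G0 iG Gub).
Qed.

(** Reads the moment recurrence at n = 0 as the vanishing of the integral of the x-derivative of g.
    The last hypothesis keeps the shape produced by [moment_gcosS] and [moment_gsinS]. *)
Lemma Rintegral_first_order (g h : R -> R) a c :
  (forall n, mu.-integrable setT (EFin \o (fun x => x ^+ n * g x))) ->
  (forall n, mu.-integrable setT (EFin \o (fun x => x ^+ n * h x))) ->
  \int[mu]_x (x ^+ 1 * g x) = 0%:R * \int[mu]_x (x ^+ 0 * g x)
    + a * \int[mu]_x (x ^+ 0 * g x) + c * \int[mu]_x (x ^+ 0 * h x) ->
  \int[mu]_x (c * h x - (x - a) * g x) = 0.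
Proof.
move=> ig ih E.
transitivity (\int[mu]_x
    (c * (x ^+ 0 * h x) + a * (x ^+ 0 * g x) - x ^+ 1 * g x)).
  by apply: eq_Rintegral => x _; rewrite !expr0 expr1; ring.
rewrite RintegralB//; last first.
  exact: (integrable_EFinD (integrable_EFinZl _ (ih _))
    (integrable_EFinZl _ (ig _))).
rewrite RintegralD//; [|exact: integrable_EFinZl..].
have Zl r (u : R -> R) : mu.-integrable setT (EFin \o u) ->
    \int[mu]_x (r * u x) = r * \int[mu]_x u x by move=> iu; exact: RintegralZl.
by rewrite (Zl _ _ (ih 0%N)) (Zl _ _ (ig 0%N)) E; ring.
Qed.

Lemma gcos_param_le a b x : `|b * gcos a b x - (x - a) * gsin a b x| <=
  (`|b| + `|x| + `|a|) * (expR (b ^+ 2 / 2) * expR (- (x - a) ^+ 2 / 2)).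
Proof.
set E := expR _ * expR _.
rewrite -addrA [leRHS]mulrDl.
apply: le_trans (ler_normB _ _) _; apply: lerD; rewrite normrM.
  by rewrite ler_wpM2l// gcos_le.
by rewrite ler_pM// ?ler_normB// gsin_le.
Qed.

Lemma gsin_param_le a b x : `|b * gsin a b x + (x - a) * gcos a b x| <=
  (`|b| + `|x| + `|a|) * (expR (b ^+ 2 / 2) * expR (- (x - a) ^+ 2 / 2)).
Proof.
set E := expR _ * expR _.
rewrite -addrA [leRHS]mulrDl.
apply: le_trans (ler_normD _ _) _; apply: lerD; rewrite normrM.
  by rewrite ler_wpM2l// gsin_le.
by rewrite ler_pM// ?ler_normB// gcos_le.
Qed.

(* By parts, the derivative of the integral with respect to b vanishes; at
   b = 0 the integrand is a normal density. *)
Lemma Rintegral_gcos a b : \int[mu]_x gcos a b x = Num.sqrt (2 * pi).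
Proof.
have i0 b' : mu.-integrable setT (EFin \o gcos a b').
  have := integrable_gcos a b' 0; rewrite (_ : (fun x => _) = gcos a b')//.
  by apply/funext => x; rewrite expr0 mul1r.
transitivity (\int[mu]_x gcos a 0 x).
  apply: (@Rintegral_param_cst (gcos a)
    (fun b x => b * gcos a b x - (x - a) * gsin a b x) a).
  - by move=> b' x; exact: is_derive_gcos_param.
  - exact: i0.
  - by move=> b' x; exact: gcos_param_le.
  - move=> b'; apply: Rintegral_first_order.
    + exact: integrable_gsin.
    + exact: integrable_gcos.
    + exact: moment_gsinS.
have -> : \int[mu]_x gcos a 0 x =
    \int[mu]_x (Num.sqrt (2 * pi) * normal_pdf a 1 x).
  apply: eq_Rintegral => x _.
  rewrite /gcos mulr0 cos0 mulr1 normal_pdfE ?oner_neq0// /normal_peak.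
  rewrite expr1n mul1r -[pi *+ 2]mulr_natl mulrA divff.
    by rewrite mul1r /normal_fun expr0n/= sub0r expr1n.
  by rewrite sqrtr_eq0 -ltNge mulr_gt0// pi_gt0.
rewrite RintegralZl//; last exact: integrable_normal_pdf.
by rewrite /Rintegral integral_normal_pdf mulr1.
Qed.

Lemma Rintegral_gsin a b : \int[mu]_x gsin a b x = 0.
Proof.
have i0 b' : mu.-integrable setT (EFin \o gsin a b').
  have := integrable_gsin a b' 0; rewrite (_ : (fun x => _) = gsin a b')//.
  by apply/funext => x; rewrite expr0 mul1r.
transitivity (\int[mu]_x gsin a 0 x).
  apply: (@Rintegral_param_cst (gsin a)
    (fun b x => b * gsin a b x + (x - a) * gcos a b x) a).
  - by move=> b' x; exact: is_derive_gsin_param.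
  - exact: i0.
  - by move=> b' x; exact: gsin_param_le.
  - move=> b'.
    (* The parameter derivative of [gsin] is minus the x-derivative of [gcos], hence the change of
       sign. *)
    transitivity (- \int[mu]_x (- b' * gsin a b' x - (x - a) * gcos a b' x)).
      rewrite -[RHS]mulN1r -RintegralZl//.
        by apply: eq_Rintegral => x _; ring.
      apply: integrable_EFinB; first exact: integrable_EFinZl.
      rewrite (_ : (fun x => _) =
          (fun x => x ^+ 1 * gcos a b' x - a * (x ^+ 0 * gcos a b' x))).
        apply: integrable_EFinB; first exact: integrable_gcos.
        by apply: integrable_EFinZl; exact: integrable_gcos.
      by apply/funext => x /=; rewrite expr0 expr1; ring.
    rewrite Rintegral_first_order ?oppr0//.
    + exact: integrable_gcos.
    + exact: integrable_gsin.
    + by rewrite mulNr; exact: moment_gcosS.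
rewrite (@eq_Rintegral _ _ _ _ _ (cst 0)) => [|x _].
  by rewrite Rintegral_cst// mul0r.
by rewrite /gsin mulr0 sin0 mulr0.
Qed.

End GaussianMoments.

(** * Complex integrals over R^m *)

Lemma ReM (R : realType) (x y : R[i]) :
  complex.Re (x * y) =
  complex.Re x * complex.Re y - complex.Im x * complex.Im y.
Proof. by case: x; case: y. Qed.

Lemma ImM (R : realType) (x y : R[i]) :
  complex.Im (x * y) =
  complex.Re x * complex.Im y + complex.Im x * complex.Re y.
Proof. by case: x; case: y. Qed.

Lemma ReD (R : realType) (x y : R[i]) :
  complex.Re (x + y) = complex.Re x + complex.Re y.
Proof. by case: x; case: y. Qed.

Lemma ImD (R : realType) (x y : R[i]) :
  complex.Im (x + y) = complex.Im x + complex.Im y.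
Proof. by case: x; case: y. Qed.

Section ComplexIntegral.
Local Open Scope classical_set_scope.
Local Open Scope ring_scope.
Context d (T : measurableType d) (R : realType).
Variable mu : {measure set T -> \bar R}.
Implicit Types f g : T -> R[i].

Definition complex_integrable f :=
  mu.-integrable setT (EFin \o (fun x => complex.Re (f x))) /\
  mu.-integrable setT (EFin \o (fun x => complex.Im (f x))).

(** The formula of [cintegral] over an arbitrary measure, so that it serves the line and the tuples
    alike. *)
Definition complex_integral f : R[i] :=
  ((\int[mu]_x complex.Re (f x)) +i* (\int[mu]_x complex.Im (f x)))%C.

Lemma complex_integrableD f g : complex_integrable f -> complex_integrable g ->
  complex_integrable (fun x => f x + g x).
Proof.
move=> [fr fi] [gr gi]; split.
  by under eq_fun do rewrite ReD; exact: integrable_EFinD.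
by under eq_fun do rewrite ImD; exact: integrable_EFinD.
Qed.

Lemma complex_integralD f g : complex_integrable f -> complex_integrable g ->
  complex_integral (fun x => f x + g x) =
  complex_integral f + complex_integral g.
Proof.
move=> [fr fi] [gr gi]; rewrite /complex_integral.
under eq_Rintegral do rewrite ReD.
under [X in (_ +i* X)%C]eq_Rintegral do rewrite ImD.
by rewrite !RintegralD.
Qed.

Lemma complex_integrableZ c f : complex_integrable f ->
  complex_integrable (fun x => c * f x).
Proof.
move=> [fr fi]; split.
  under eq_fun do rewrite ReM.
  by apply: integrable_EFinB; exact: integrable_EFinZl.
under eq_fun do rewrite ImM.
by apply: integrable_EFinD; exact: integrable_EFinZl.
Qed.

Lemma complex_integralZ c f : complex_integrable f ->
  complex_integral (fun x => c * f x) = c * complex_integral f.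
Proof.
move=> [fr fi]; rewrite /complex_integral.
under eq_Rintegral do rewrite ReM.
under [X in (_ +i* X)%C]eq_Rintegral do rewrite ImM.
rewrite RintegralB//; try exact: integrable_EFinZl.
rewrite RintegralD//; try exact: integrable_EFinZl.
by rewrite !RintegralZl//; case: c.
Qed.

End ComplexIntegral.

(** * Fubini for products of functions in separate variables *)

Section ProductIntegral.
Local Open Scope classical_set_scope.
Local Open Scope ring_scope.
Context d1 d2 (T1 : measurableType d1) (T2 : measurableType d2) (R : realType).
Variables (m1 : {sigma_finite_measure set T1 -> \bar R})
  (m2 : {sigma_finite_measure set T2 -> \bar R}).
Variables (u : T1 -> R) (v : T2 -> R).
Hypotheses (iu : m1.-integrable setT (EFin \o u))
  (iv : m2.-integrable setT (EFin \o v)).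

Lemma integrable_prod_mul :
  (m1 \x m2)%E.-integrable setT (EFin \o (fun p => u p.1 * v p.2)).
Proof.
have mu1 : measurable_fun setT u by apply/measurable_EFinP/(measurable_int m1).
have mv : measurable_fun setT v by apply/measurable_EFinP/(measurable_int m2).
apply/integrable12ltyP.
  apply/measurable_EFinP; apply: measurable_funM.
    exact: (measurableT_comp mu1 measurable_fst).
  exact: (measurableT_comp mv measurable_snd).
rewrite (@eq_integral _ _ _ _ _ (fun x =>
    (`|u x|)%:E * (\int[m2]_y (`|v y|)%:E))%E) => [|x _]; last first.
  rewrite -ge0_integralZl_EFin//.
    by apply: eq_integral => y _; rewrite -EFinM/= normrM.
  by apply/measurable_EFinP; exact: measurableT_comp.
rewrite ge0_integralZr//.
- apply: lte_mul_pinfty; first exact: integral_ge0.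
    rewrite ge0_fin_numE; last exact: integral_ge0.
    by have /integrableP[_] := iu.
  by have /integrableP[_] := iv.
- by apply/measurable_EFinP; exact: measurableT_comp.
- exact: integral_ge0.
Qed.

Lemma Rintegral_prod_mul :
  \int[(m1 \x m2)%E]_p (u p.1 * v p.2) = (\int[m1]_x u x) * (\int[m2]_y v y).
Proof.
rewrite /Rintegral -(integral12_prod_meas1 integrable_prod_mul) /fubini_F/=.
rewrite -fineM; try exact: integrable_fin_num.
congr fine.
rewrite (@eq_integral _ _ _ _ _ (fun x =>
    (u x)%:E * (\int[m2]_y (v y)%:E))%E) => [|x _]; last first.
  rewrite -integralZl//.
have := integrable_fin_num measurableT iv.
rewrite /comp; case: (\int[m2]_y _)%E => // r _.
by rewrite integralZr.
Qed.

End ProductIntegral.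

Section LebesgueTuple.
Local Open Scope classical_set_scope.
Local Open Scope ring_scope.
Variable R : realType.
Local Notation T := (measurableTypeR R).

Section Cons.
Variables (n : nat) (nu : {sigma_finite_measure set (n.-tuple T) -> \bar R}).
Variables (u : T -> R) (v : n.-tuple T -> R).
Hypotheses (iu : (@lebesgue_measure R).-integrable setT (EFin \o u))
  (iv : nu.-integrable setT (EFin \o v)).

Let f (t : n.+1.-tuple T) := u (thead t) * v [tuple of behead t].

Let ftcons p : f (tcons p) = u p.1 * v p.2.
Proof.
case: p => a t; rewrite /f /tcons theadE; congr (_ * v _).
exact: val_inj.
Qed.

Let mf : measurable_fun setT f.
Proof.
apply: measurable_funM.
  apply: (measurableT_comp (f := u)).
    by have /integrableP[/measurable_EFinP] := iu.
  exact: measurable_tnth.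
apply: (measurableT_comp (f := v)).
  by have /integrableP[/measurable_EFinP] := iv.
exact: measurable_behead.
Qed.

Lemma integrable_lebesgue_cons :
  (lebesgue_cons nu).-integrable setT (EFin \o f).
Proof.
apply: (integrable_pushforward (@measurable_tcons R n)) => //.
  exact/measurable_EFinP.
rewrite preimage_setT (_ : _ \o _ = EFin \o (fun p => u p.1 * v p.2)).
  exact: (integrable_prod_mul (T1 := T) iu iv).
by apply/funext => p /=; rewrite ftcons.
Qed.

Lemma Rintegral_lebesgue_cons :
  \int[lebesgue_cons nu]_t f t =
  (\int[lebesgue_measure]_x u x) * \int[nu]_t v t.
Proof.
rewrite -(Rintegral_prod_mul (T1 := T) iu iv) /Rintegral.
congr fine.
rewrite -[LHS]/(\int[pushforward _ _]_t (EFin \o f) t)%E integral_pushforward//.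
- by rewrite preimage_setT; apply: eq_integral => p _ /=; rewrite ftcons.
- exact: measurable_tcons.
- exact/measurable_EFinP.
rewrite preimage_setT (_ : _ \o _ = EFin \o (fun p => u p.1 * v p.2)).
  exact: (integrable_prod_mul (T1 := T) iu iv).
by apply/funext => p /=; rewrite ftcons.
Qed.

End Cons.

Section ComplexCons.
Variables (n : nat) (nu : {sigma_finite_measure set (n.-tuple T) -> \bar R}).
Variables (u : T -> R[i]) (v : n.-tuple T -> R[i]).
Hypotheses (iu : complex_integrable (@lebesgue_measure R) u)
  (iv : complex_integrable nu v).

Lemma complex_integrable_lebesgue_cons : complex_integrable (lebesgue_cons nu)
  (fun t => u (thead t) * v [tuple of behead t]).
Proof.
have [ru cu] := iu; have [rv cv] := iv; split.
  under eq_fun do rewrite ReM.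
  by apply: integrable_EFinB; [exact: (integrable_lebesgue_cons ru rv)|
    exact: (integrable_lebesgue_cons cu cv)].
under eq_fun do rewrite ImM.
by apply: integrable_EFinD; [exact: (integrable_lebesgue_cons ru cv)|
  exact: (integrable_lebesgue_cons cu rv)].
Qed.

Lemma complex_integral_lebesgue_cons : complex_integral (lebesgue_cons nu)
    (fun t => u (thead t) * v [tuple of behead t]) =
  complex_integral lebesgue_measure u * complex_integral nu v.
Proof.
have [ru cu] := iu; have [rv cv] := iv.
apply/eqP; rewrite eq_complex/=; apply/andP; split; apply/eqP.
  under eq_Rintegral do rewrite ReM.
  rewrite RintegralB//; [|exact: (integrable_lebesgue_cons ru rv)|
    exact: (integrable_lebesgue_cons cu cv)].
  by rewrite (Rintegral_lebesgue_cons ru rv) (Rintegral_lebesgue_cons cu cv).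
under eq_Rintegral do rewrite ImM.
rewrite RintegralD//; [|exact: (integrable_lebesgue_cons ru cv)|
  exact: (integrable_lebesgue_cons cu rv)].
by rewrite (Rintegral_lebesgue_cons ru cv) (Rintegral_lebesgue_cons cu rv).
Qed.

End ComplexCons.

(** Induction on n, splitting off the head coordinate. Integrability and value are proved together
    because the Fubini step requires the tail to be integrable. *)
Lemma complex_integral_tuple_prod n (g : 'I_n -> T -> R[i]) :
  (forall j, complex_integrable (@lebesgue_measure R) (g j)) ->
  complex_integrable (lebesgue_tuple R n) (fun t => \prod_j g j (tnth t j)) /\
  complex_integral (lebesgue_tuple R n) (fun t => \prod_j g j (tnth t j)) =
  \prod_j complex_integral (@lebesgue_measure R) (g j).
Proof.
elim: n g => [|n IHn] g ig.
  (* For n = 0 the measure is the Dirac mass at the empty tuple; its total mass 1 matches the empty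
     product. *)
  have E : (fun t : 0.-tuple T => \prod_j g j (tnth t j)) = cst 1.
    by apply/funext => t; rewrite big_ord0.
  rewrite E big_ord0; split.
    split; exact: (@finite_measure_integrable_cst _ _ R (\d_[tuple])).
  rewrite /complex_integral /= !Rintegral_cst//=.
  by rewrite indicE in_setT mulr1 mul0r.
have [iG GE] := IHn (fun j => g (lift ord0 j)) (fun j => ig (lift ord0 j)).
have -> : (fun t : n.+1.-tuple T => \prod_j g j (tnth t j)) =
    (fun t => g ord0 (thead t) *
      \prod_j g (lift ord0 j) (tnth [tuple of behead t] j)).
  apply/funext => t; rewrite big_ord_recl; congr (_ * _).
  apply: eq_bigr => j _; congr (g _ _).
  by rewrite [in RHS](tnth_nth (thead t)) nth_behead (tnth_nth (thead t)).
split; first exact: (complex_integrable_lebesgue_cons (ig ord0) iG).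
by rewrite (complex_integral_lebesgue_cons (ig ord0) iG) GE big_ord_recl.
Qed.

End LebesgueTuple.

(** * The one-dimensional kernel at a complex point and its moments *)

Section GaussianKernel.
Local Open Scope classical_set_scope.
Local Open Scope ring_scope.
Variable R : realType.
Local Notation mu := (@lebesgue_measure R).
Implicit Types (z : R[i]) (x : R).

Lemma cexpD (z w : R[i]) : cexp (z + w) = cexp z * cexp w.
Proof.
case: z w => [a b] [c d]; rewrite /cexp/= expRD cosD sinD.
by apply/eqP; rewrite eq_complex/=; apply/andP; split; apply/eqP; ring.
Qed.

Lemma cexp0 : cexp 0 = 1 :> R[i].
Proof. by rewrite /cexp/= expR0 cos0 sin0 mulr1 mulr0. Qed.

Lemma cexp_sum (I : Type) (r : seq I) (P : pred I) (F : I -> R[i]) :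
  cexp (\sum_(i <- r | P i) F i) = \prod_(i <- r | P i) cexp (F i).
Proof. exact: (big_morph _ cexpD cexp0). Qed.

Lemma cexp_real x : cexp (x%:C)%C = ((expR x)%:C)%C.
Proof. by rewrite /cexp/= cos0 sin0 mulr1 mulr0. Qed.

Definition gauss_kernel z x : R[i] :=
  cexp (- (z * z / 2) + (x%:C)%C * z - ((x * x / 2)%:C)%C).

(** Complete the square: the exponent is - (x - z)^2 / 2, with real part (b^2 - (x - a)^2) / 2 and
    imaginary part (x - a) b. *)
Lemma gauss_kernelE z x : gauss_kernel z x =
  (gcos (complex.Re z) (complex.Im z) x +i*
   gsin (complex.Re z) (complex.Im z) x)%C.
Proof.
case: z => a b /=; rewrite /gauss_kernel.
have -> : - ((a +i* b)%C * (a +i* b)%C / 2) + (x%:C)%C * (a +i* b)%C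
    - ((x * x / 2)%:C)%C =
    (((b ^+ 2 - (x - a) ^+ 2) / 2) +i* ((x - a) * b))%C.
  have -> : (2 : R[i])^-1 = ((2^-1)%:C)%C by rewrite fmorphV rmorph_nat.
  by apply/eqP; rewrite eq_complex/=; apply/andP; split; apply/eqP; field.
by [].
Qed.

Definition gauss_moment z n : R[i] :=
  complex_integral mu (fun x => gauss_kernel z x * ((x ^+ n)%:C)%C).

Let ReKM z n x : complex.Re (gauss_kernel z x * ((x ^+ n)%:C)%C) =
  x ^+ n * gcos (complex.Re z) (complex.Im z) x.
Proof. by rewrite ReM gauss_kernelE/= mulr0 subr0 mulrC. Qed.

Let ImKM z n x : complex.Im (gauss_kernel z x * ((x ^+ n)%:C)%C) =
  x ^+ n * gsin (complex.Re z) (complex.Im z) x.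
Proof. by rewrite ImM gauss_kernelE/= mulr0 add0r mulrC. Qed.

Lemma integrable_gauss_moment z n :
  complex_integrable mu (fun x => gauss_kernel z x * ((x ^+ n)%:C)%C).
Proof.
split; first by under eq_fun do rewrite ReKM; exact: integrable_gcos.
by under eq_fun do rewrite ImKM; exact: integrable_gsin.
Qed.

Let gauss_momentE z n : gauss_moment z n =
  ((\int[mu]_x (x ^+ n * gcos (complex.Re z) (complex.Im z) x)) +i*
   (\int[mu]_x (x ^+ n * gsin (complex.Re z) (complex.Im z) x)))%C.
Proof.
by congr (_ +i* _)%C; apply: eq_Rintegral => x _; rewrite ?ReKM ?ImKM.
Qed.

Lemma gauss_moment0 z : gauss_moment z 0 = ((Num.sqrt (2 * pi))%:C)%C.
Proof.
rewrite gauss_momentE.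
under eq_Rintegral do rewrite expr0 mul1r.
under [X in (_ +i* X)%C]eq_Rintegral do rewrite expr0 mul1r.
by rewrite Rintegral_gcos Rintegral_gsin.
Qed.

Lemma gauss_momentS z n :
  gauss_moment z n.+1 = z * gauss_moment z n + n%:R * gauss_moment z n.-1.
Proof.
rewrite !gauss_momentE moment_gcosS moment_gsinS.
have -> : n%:R = (n%:R%:C)%C :> R[i] by rewrite rmorph_nat.
case: z => a b /=.
by apply/eqP; rewrite eq_complex/=; apply/andP; split; apply/eqP; ring.
Qed.

End GaussianKernel.

(** * The operator x - D on Clifford polynomials *)

Lemma cl_genM (K : comNzRingType) (m : nat) (j : 'I_m) (x : clifford K m) A :
  (cl_gen K j * x) A =
  (-1) ^+ inversions [set j] (symdiff [set j] A) * x (symdiff [set j] A).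
Proof.
rewrite ffunE (bigD1 [set j])//= big1 ?addr0 => [|B Bj].
  by rewrite ffunE eqxx mul1r.
by rewrite ffunE (negbTE Bj) mul0r mulr0.
Qed.

Lemma cl_sumE (K : comNzRingType) (m : nat) (I : Type) (r : seq I) (P : pred I)
  (F : I -> clifford K m) A :
  (\sum_(i <- r | P i) F i) A = \sum_(i <- r | P i) F i A.
Proof.
by apply: (big_morph (fun x : clifford K m => x A)) => [x y|]; rewrite ffunE.
Qed.

Section CliffordMap.
Variables (K L : comNzRingType) (m : nat).
Implicit Types (x y : clifford K m) (A : {set 'I_m}).

Variable f : K -> L.
Hypothesis fB : {morph f : a b / a - b}.

Let f0 : f 0 = 0.
Proof. by rewrite -[0 in LHS](subrr 0) fB subrr. Qed.

Let fN : {morph f : a / - a}.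
Proof. by move=> a; rewrite -[LHS](congr1 f (sub0r a)) fB f0 sub0r. Qed.

Let fD : {morph f : a b / a + b}.
Proof. by move=> a b; rewrite -[b in LHS]opprK fB fN opprK. Qed.

Lemma cl_map_sum (I : Type) (r : seq I) (P : pred I) (F : I -> clifford K m) :
  cl_map f (\sum_(i <- r | P i) F i) = \sum_(i <- r | P i) cl_map f (F i).
Proof.
apply: (big_morph (cl_map f)) => [x y|]; apply/ffunP => A.
  by rewrite !ffunE fD.
by rewrite !ffunE.
Qed.

(** By [cl_genM], multiplication by e_j on the left is a signed permutation of the coordinates, so
    every additive f commutes with it. It is applied to partial derivatives, to evaluation and to
    the Gaussian functional. *)
Lemma cl_map_genM j x : cl_map f (cl_gen K j * x) = cl_gen L j * cl_map f x.
Proof.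
apply/ffunP => A; rewrite cl_genM [LHS]ffunE cl_genM ffunE.
rewrite -signr_odd -[in RHS]signr_odd.
by case: odd; rewrite ?expr0 ?expr1 ?mul1r ?mulN1r.
Qed.

End CliffordMap.

Section Polynomials.
Variables (R : realType) (m : nat).
Local Notation mp := (mpoly.mpoly m R).
Implicit Types (p q : mp) (P Q : clpoly R m).

Definition mvar (j : 'I_m) : mp := mpoly.mpolyX R (mpoly.mnm1 j).

Definition formal_partial (j : 'I_m) P : clpoly R m :=
  cl_map (mpoly.mderiv j) P.

Definition formal_dirac P : clpoly R m :=
  \sum_(j < m) cl_gen mp j * formal_partial j P.

(* The formal counterpart of the operator x - D. *)
Definition creation P : clpoly R m :=
  \sum_(j < m) cl_gen mp j * (mvar j *: P - formal_partial j P).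

Lemma formal_partial_sum j (I : Type) (r : seq I) (B : pred I)
    (F : I -> clpoly R m) :
  formal_partial j (\sum_(i <- r | B i) F i) =
  \sum_(i <- r | B i) formal_partial j (F i).
Proof. exact: (cl_map_sum (@mpoly.mderivB _ _ _)). Qed.

Lemma formal_partial_genM i j P :
  formal_partial i (cl_gen mp j * P) = cl_gen mp j * formal_partial i P.
Proof. exact: (cl_map_genM (@mpoly.mderivB _ _ _)). Qed.

Lemma formal_partialC i j P :
  formal_partial i (formal_partial j P) = formal_partial j (formal_partial i P).
Proof. by apply/ffunP => A; rewrite !ffunE mpoly.mderiv_comm. Qed.

(** Adding the double sum to its transpose puts e_i e_j + e_j e_i in front of the symmetric second
    derivatives: only the diagonal survives, with 2 e_i^2 = -2. This is why both sides are
    doubled. *)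
Lemma formal_dirac_sqr P : (formal_dirac (formal_dirac P)) *+ 2 =
  - (\sum_(j < m) formal_partial j (formal_partial j P)) *+ 2.
Proof.
have E : formal_dirac (formal_dirac P) = \sum_(i < m) \sum_(j < m)
    cl_gen mp i * cl_gen mp j * formal_partial i (formal_partial j P).
  apply: eq_bigr => i _; rewrite formal_partial_sum mulr_sumr.
  by apply: eq_bigr => j _; rewrite formal_partial_genM mulrA.
rewrite mulr2n {2}E exchange_big/= E -big_split/= -sumrN -sumrMnl.
apply: eq_bigr => i _; rewrite -big_split/= (bigD1 i)//= big1 => [|j ji].
  by rewrite addr0 -mulr2n cl_gen_sqr mulN1r.
by rewrite formal_partialC -mulrDl cl_gen_anticomm ?mul0r// eq_sym.
Qed.

Lemma harmonic_of_formal_dirac P : formal_dirac P = 0 ->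
  forall A, \sum_(j < m) mpoly.mderiv j (mpoly.mderiv j (P A)) = 0.
Proof.
move=> DP A.
pose S := \sum_(j < m) formal_partial j (formal_partial j P).
have S0 : S = 0.
  have /eqP := formal_dirac_sqr P; rewrite DP.
  have -> : formal_dirac 0 = 0.
    rewrite /formal_dirac big1// => j _.
    have -> : formal_partial j 0 = 0.
      by apply/ffunP => B; rewrite !ffunE mpoly.mderiv0.
    by rewrite mulr0.
  rewrite mul0rn eq_sym mulNrn oppr_eq0 -scaler_nat => /eqP S20.
  (* The scalars of [clpoly] are polynomials, so 2 is cancelled by the constant polynomial 1/2. *)
  have u2 : (mpoly.mpolyC m (2^-1 : R)) * 2%:R = 1.
    have := congr1 (@mpoly.mpolyC m R) (mulVf (lt0r_neq0 (ltr0Sn R 1))).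
    by rewrite rmorphM/= rmorph_nat.
  by rewrite -[LHS]scale1r -u2 -scalerA S20 scaler0.
transitivity (S A); last by rewrite S0 ffunE.
by rewrite cl_sumE; apply: eq_bigr => j _; rewrite !ffunE.
Qed.

Lemma mcoeff_mvar_mderiv j p a :
  mpoly.mcoeff a (mvar j * mpoly.mderiv j p) = (a j)%:R * mpoly.mcoeff a p.
Proof.
elim/mpoly.mpolyind: p => [|c b p _ _ IH].
  by rewrite mpoly.mderiv0 mulr0 !mpoly.mcoeff0 mulr0.
rewrite mpoly.mderivD mpoly.mderivZ mulrDr !mpoly.mcoeffD IH mulrDr.
congr (_ + _).
rewrite -scalerAr !mpoly.mcoeffZ mpoly.mderivX mpoly.mcoeffX.
rewrite -scalerAr mpoly.mcoeffZ.
(* Subtraction of exponents is truncated: x_j times x^(b - e_j) is x^b only when b_j > 0. *)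
have [bj|bj] := eqVneq (b j) 0%N.
  rewrite bj mul0r mulr0; case: eqVneq => [<-|_]; last by rewrite !mulr0.
  by rewrite bj mul0r.
rewrite /mvar -mpoly.mpolyXD mpoly.mcoeffX mpoly.addmC mpoly.submK; last first.
  by rewrite mpoly.lep1mP.
by case: eqVneq => [->|_]; rewrite ?mulr0// !mulr1 mulrC.
Qed.

(** Each x_j d_j is diagonal on monomials, with eigenvalue a_j on x^a, and the a_j add up to the
    degree. Homogeneity is phrased on coefficients, a form that passes easily to derivatives. *)
Lemma euler_identity k p :
  (forall a, mpoly.mcoeff a p != 0 -> mpoly.mdeg a = k) ->
  \sum_(j < m) mvar j * mpoly.mderiv j p = k%:R *: p.
Proof.
move=> hom; apply/mpoly.mpolyP => a.
rewrite raddf_sum/= mpoly.mcoeffZ.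
under eq_bigr do rewrite mcoeff_mvar_mderiv.
rewrite -mulr_suml -natr_sum.
have [->|/hom <-] := eqVneq (mpoly.mcoeff a p) 0; first by rewrite !mulr0.
by rewrite mpoly.mdegE.
Qed.

(** * Functionals obeying the moment recurrence *)

Section Functional.
Variables (z : 'rV[R[i]]_m) (phi : mp -> R[i]).
Hypotheses (phiB : {morph phi : p q / p - q})
  (phiZ : forall c p, phi (c *: p) = (c%:C)%C * phi p)
  (phi1 : phi 1 = 1)
  (phiX : forall j p,
    phi (mvar j * p) = z 0 j * phi p + phi (mpoly.mderiv j p)).

Lemma functional_creation P :
  cl_map phi (creation P) = cl_vec z * cl_map phi P.
Proof.
rewrite (cl_map_sum phiB) mulr_suml; apply: eq_bigr => j _.
rewrite (cl_map_genM phiB) -scalerAl; rewrite cl_scaleAr; congr (_ * _).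
apply/ffunP => A; rewrite cl_scaleE !ffunE phiB phiX.
by rewrite addrK.
Qed.

Lemma functional_iter_creation l P :
  cl_map phi (iter l creation P) = cl_vec z ^+ l * cl_map phi P.
Proof.
elim: l => [|l IH]; first by rewrite mul1r.
by rewrite iterS functional_creation IH mulrA exprS.
Qed.

(** Evaluation at z obeys the same Euler recursion as [phi], without the Laplacian term, so the two
    agree when that term vanishes. *)
Lemma functional_harmonic k p :
  (forall a, mpoly.mcoeff a p != 0 -> mpoly.mdeg a = k) ->
  \sum_(j < m) mpoly.mderiv j (mpoly.mderiv j p) = 0 ->
  phi p = mpoly.mmap (real_complex R) (fun j => z 0 j) p.
Proof.
have phi0 : phi 0 = 0 by rewrite -[0 in LHS](subrr 0) phiB subrr.
have phiD : {morph phi : p q / p + q}.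
  move=> u v; rewrite -[v in LHS]opprK phiB -[- v]sub0r phiB phi0.
  by rewrite sub0r opprK.
elim: k p => [|k IH] p hom harm.
  have -> : p = mpoly.mcoeff mpoly.mnm0 p *: 1.
    apply/mpoly.mpolyP => a; rewrite mpoly.mcoeffZ mpoly.mcoeff1.
    have [->|a0] := eqVneq a mpoly.mnm0; first by rewrite mulr1.
    rewrite mulr0; apply/eqP/contraT => /hom/eqP.
    by rewrite mpoly.mdeg_eq0 (negbTE a0).
  by rewrite phiZ phi1 mpoly.mmapZ rmorph1.
have k0 : (k.+1%:R : R[i]) != 0 by rewrite pnatr_eq0.
apply: (mulfI k0).
have kC : k.+1%:R = (k.+1%:R%:C)%C :> R[i] by rewrite rmorph_nat.
rewrite kC -phiZ -mpoly.mmapZ -(euler_identity hom).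
rewrite (big_morph phi phiD phi0) raddf_sum/=.
(* Here [phi 0] stands for the value of [phi] at the Laplacian of p. *)
transitivity (\sum_(j < m) (z 0 j * phi (mpoly.mderiv j p)) + phi 0).
  rewrite -harm (big_morph phi phiD phi0) -big_split/=.
  by apply: eq_bigr => j _; rewrite phiX.
rewrite phi0 addr0; apply: eq_bigr => j _.
rewrite rmorphM/= (IH (mpoly.mderiv j p)).
- by rewrite /mvar mpoly.mmapX mpoly.mmap1U.
- move=> a; rewrite mpoly.mcoeff_mderiv; move=> ne.
  have : mpoly.mcoeff (mpoly.mnm_add a (mpoly.mnm1 j)) p != 0.
    by apply: contraNneq ne => ->; rewrite mul0rn.
  by move/hom; rewrite mpoly.mdegD mpoly.mdeg1 addn1 => -[].
(* A derivative of a harmonic polynomial is harmonic, since partial derivatives commute. *)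
transitivity (mpoly.mderiv j (\sum_(i < m) mpoly.mderiv i (mpoly.mderiv i p))).
  rewrite raddf_sum/=; apply: eq_bigr => i _.
  rewrite [mpoly.mderiv i (mpoly.mderiv j p)]mpoly.mderiv_comm.
  exact: mpoly.mderiv_comm.
by rewrite harm mpoly.mderiv0.
Qed.

End Functional.
End Polynomials.

(** * Analytic and formal Dirac operators *)

Section Derivatives.
Variables (R : realType) (m : nat).
Local Notation mp := (mpoly.mpoly m R).
Local Notation V := 'rV[R]_m.
Implicit Types (p q : mp) (P Q : clpoly R m) (x v : V).

Definition peval p x : R := mpoly.meval (fun j => x 0 j) p.

(** Restricting to the line h -> h v + x turns the directional derivative into an ordinary one at 0,
    where the one-variable chain rule applies. *)
Lemma is_derive_expR_comp (f : V -> R) x v (df : R) : is_derive x v f df ->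
  is_derive x v (fun y => expR (f y)) (expR (f x) * df).
Proof.
move=> [fd fdE].
have DE (k : V -> R) :
    'D_v k x = 'D_(1 : R) (fun h : R => k (h *: v + x)) (0 : R).
  rewrite /derive; set g1 := fun h => h^-1 *: _; set g2 := fun h => h^-1 *: _.
  suff -> : g1 = g2 by [].
  by apply/funext => h; rewrite /g1 /g2 /= addr0 scale0r add0r [_%:A]mulr1.
pose g (h : R) := f (h *: v + x).
have gd : is_derive (0 : R) (1 : R) g df.
  by apply: DeriveDef; [exact: (derivable1P f x v).1|rewrite -DE].
have [ed1 ed2] : is_derive (0 : R) (1 : R)
    (fun h => expR (g h)) (expR (g 0) * df).
  exact: (is_derive1_comp (f := expR)).
apply: DeriveDef; first exact: (derivable1P (fun y => expR (f y)) x v).2.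
by rewrite DE ed2 /g scale0r add0r.
Qed.

Lemma is_derive_coord (i : 'I_m) x v :
  is_derive x v (fun y : V => y 0 i) (v 0 i).
Proof.
have cv : ((fun h : R =>
    h^-1 *: (((fun y : V => y 0 i) \o shift x) (h *: v) - x 0 i)) @ 0^' -->
    v 0 i)%classic.
  apply: cvg_near_cst; near=> h.
  have h0 : h != 0 by near: h; exact: nbhs_dnbhs_neq.
  by rewrite /= !mxE addrK scalerA mulVf// scale1r.
apply: DeriveDef; first by apply/cvg_ex; exists (v 0 i).
exact/cvg_lim.
Unshelve. all: by end_near.
Qed.

Lemma is_derive_peval (j : 'I_m) p x :
  is_derive x (delta_mx 0 j) (peval p) (peval (mpoly.mderiv j p) x).
Proof.
(* [D] is stable under sums and products and holds for constants and variables, which generate all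
   polynomials. *)
pose D q := is_derive x (delta_mx 0 j) (peval q) (peval (mpoly.mderiv j q) x).
have DD q r : D q -> D r -> D (q + r).
  rewrite /D => dq dr; rewrite mpoly.mderivD.
  have -> : peval (q + r) = peval q + peval r.
    by apply/funext => y; rewrite /peval mpoly.mevalD.
  by rewrite /peval mpoly.mevalD; exact: is_deriveD.
have DM q r : D q -> D r -> D (q * r).
  rewrite /D => dq dr; rewrite mpoly.mderivM.
  have -> : peval (q * r) = peval q * peval r.
    by apply/funext => y; rewrite /peval mpoly.mevalM.
  apply: is_derive_eq; rewrite /peval mpoly.mevalD !mpoly.mevalM /GRing.scale/=.
  by rewrite addrC mulrC.
have DC c : D (mpoly.mpolyC m c).
  rewrite /D mpoly.mderivC /peval mpoly.meval0.
  have -> : (fun y : V =>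
      mpoly.meval (fun i => y 0 i) (mpoly.mpolyC m c)) = cst c.
    by apply/funext => y; rewrite mpoly.mevalC.
  exact: is_derive_cst.
have DX i : D (mvar R i).
  rewrite /D /mvar mpoly.mderivX mpoly.mnm1E /peval.
  have -> : (fun y : V =>
      mpoly.meval (fun i => y 0 i) (mpoly.mpolyX R (mpoly.mnm1 i))) =
      (fun y : V => y 0 i).
    by apply/funext => y; rewrite mpoly.mevalXU.
  apply: (@is_derive_eq _ _ _ _ _ _ _ _ (is_derive_coord i x (delta_mx 0 j))).
  rewrite mxE eqxx/= mpoly.mevalZ.
  have [->|ij] := eqVneq i j; last by rewrite mul0r.
  by rewrite mul1r mpoly.mevalX big1// => k _; rewrite mpoly.mnmBE subnn expr0.
rewrite -/(D p); elim/mpoly.mpolyind: p => [|c a p _ _ IH].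
  by rewrite -mpoly.mpolyC0; exact: DC.
apply: (DD _ _ _ IH); rewrite -mpoly.mul_mpolyC; apply: (DM _ _ (DC c)).
have D1 : D 1 by rewrite -mpoly.mpolyC1; exact: DC.
rewrite mpoly.mpolyXE_id; apply: (big_ind D D1 DM) => i _.
by elim: (a i) => [|n IHn]; rewrite ?expr0// exprS; exact: (DM _ _ (DX i) IHn).
Qed.

(** Induction on the degree of the monomial whose coefficient is read. The constant coefficient is
    the value at 0; if a_i > 0, the coefficient of x^a is, up to a nonzero integer factor, one of
    d_i p, which vanishes identically as well. This carries D P = 0 from functions to
    polynomials. *)
Lemma peval_eq0 p : (forall x, peval p x = 0) -> p = 0.
Proof.
move=> p0; apply/mpoly.mpolyP => a; rewrite mpoly.mcoeff0.
have [n] := ubnP (mpoly.mdeg a); elim: n => // n IH in p p0 a *.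
rewrite ltnS => an.
have [->|] := eqVneq a mpoly.mnm0.
  have <- := p0 0.
  elim/mpoly.mpolyind: p {p0} => [|c b q _ _ IHp].
    by rewrite mpoly.mcoeff0 /peval mpoly.meval0.
  rewrite mpoly.mcoeffD mpoly.mcoeffZ /peval mpoly.mevalD IHp; congr (_ + _).
  rewrite mpoly.mevalZ mpoly.mcoeffX mpoly.mevalX; congr (_ * _).
  have [->|] := eqVneq b mpoly.mnm0.
    by rewrite big1// => i _; rewrite mpoly.mnm0E expr0.
  rewrite -mpoly.mdeg_eq0 mpoly.mdegE sum_nat_eq0 negb_forall.
  move=> /existsP[i /= bi].
  by rewrite (bigD1 i)//= mxE expr0n (negbTE bi) mul0r.
rewrite -mpoly.mdeg_eq0 mpoly.mdegE sum_nat_eq0 negb_forall.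
move=> /existsP[i /= ai].
have ai1 := ai; rewrite -mpoly.lep1mP in ai1.
have : mpoly.mcoeff (mpoly.mnm_sub a (mpoly.mnm1 i)) (mpoly.mderiv i p) = 0.
  apply: IH => [x|].
    have [_ <-] := is_derive_peval i p x.
    have -> : peval p = cst 0 by apply/funext => y; rewrite p0.
    by rewrite derive_cst.
  rewrite (leq_trans _ an)// -[in leqRHS](mpoly.submK ai1).
  by rewrite mpoly.mdegD mpoly.mdeg1 addn1.
rewrite mpoly.mcoeff_mderiv mpoly.submK// -mulr_natr => /eqP.
by rewrite mulf_eq0 pnatr_eq0 orbF => /eqP.
Qed.

Lemma clpoly_evalE P x A : clpoly_eval P x A = peval (P A) x.
Proof. by rewrite ffunE. Qed.

Lemma cl_partial_eval j P :
  cl_partial j (clpoly_eval P) = clpoly_eval (formal_partial j P).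
Proof.
apply/funext => x; apply/ffunP => A; rewrite clpoly_evalE !ffunE.
have [_ <-] := is_derive_peval j (P A) x.
by congr ('D__ _ _); apply/funext => y; rewrite clpoly_evalE.
Qed.

Let evB x : {morph mpoly.meval (fun j => x 0 j) : p q / p - q}.
Proof. exact: mpoly.mevalB. Qed.

Lemma clpoly_eval_sum_gen (F : 'I_m -> clpoly R m) x :
  clpoly_eval (\sum_(j < m) cl_gen mp j * F j) x =
  \sum_(j < m) cl_gen R j * clpoly_eval (F j) x.
Proof.
rewrite /clpoly_eval (cl_map_sum (evB x)).
by apply: eq_bigr => j _; rewrite (cl_map_genM (evB x)).
Qed.

Lemma dirac_op_eval P x :
  dirac_op (clpoly_eval P) x = clpoly_eval (formal_dirac P) x.
Proof.
by rewrite clpoly_eval_sum_gen; apply: eq_bigr => j _; rewrite cl_partial_eval.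
Qed.

Lemma formal_dirac_eq0 P : (forall x, dirac_op (clpoly_eval P) x = 0) ->
  formal_dirac P = 0.
Proof.
move=> DP; apply/ffunP => A; rewrite [RHS]ffunE; apply: peval_eq0 => x.
by rewrite -clpoly_evalE -dirac_op_eval DP ffunE.
Qed.

(** As a polynomial, |x|^2 inherits differentiability and measurability from [peval]. *)
Definition sqnorm_poly : mp := \sum_(j < m) mvar R j ^+ 2.

Lemma peval_sqnorm x : peval sqnorm_poly x = sqnorm x.
Proof.
rewrite /peval rmorph_sum/=; apply: eq_bigr => j _.
by rewrite rmorphXn/= mpoly.mevalXU.
Qed.

Lemma mderiv_sqnorm j : mpoly.mderiv j sqnorm_poly = 2%:R *: mvar R j.
Proof.
rewrite /sqnorm_poly raddf_sum/= (bigD1 j)//= big1 => [|i ij].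
  rewrite expr2 mpoly.mderivM /mvar mpoly.mderivX mpoly.mnm1E eqxx scale1r.
  have -> : mpoly.mnm_sub (mpoly.mnm1 j) (mpoly.mnm1 j) = mpoly.mnm0.
    by apply/mpoly.mnmP => i; rewrite mpoly.mnmBE subnn mpoly.mnm0E.
  by rewrite mpoly.mpolyX0 mul1r mulr1 addr0 scaler_nat mulr2n.
rewrite expr2 mpoly.mderivM /mvar mpoly.mderivX mpoly.mnm1E (negbTE ij) scale0r.
by rewrite mul0r mulr0 addr0.
Qed.

Lemma is_derive_gauss j x : is_derive x (delta_mx 0 j)
  (fun y => expR (- (sqnorm y / 2))) (- (x 0 j * expR (- (sqnorm x / 2)))).
Proof.
have d := is_derive_peval j ((- 2^-1 : R) *: sqnorm_poly) x.
have E y : peval ((- 2^-1 : R) *: sqnorm_poly) y = - (sqnorm y / 2).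
  by rewrite /peval mpoly.mevalZ -/(peval _ _) peval_sqnorm mulNr mulrC.
have := is_derive_expR_comp d.
under eq_fun do rewrite E.
move=> H; apply: (@is_derive_eq _ _ _ _ _ _ _ _ H).
rewrite E mpoly.mderivZ mderiv_sqnorm /peval !mpoly.mevalZ mpoly.mevalXU.
by rewrite mulrA mulNr mulVf// mulN1r mulrN mulrC.
Qed.

(** Leibniz rule: d_j (e^(- |x|^2 / 2) P) = - e^(- |x|^2 / 2) (x_j P - d_j P). *)
Lemma dirac_op_gauss P x :
  dirac_op (fun y => expR (- (sqnorm y / 2)) *: clpoly_eval P y) x =
  - (expR (- (sqnorm x / 2)) *: clpoly_eval (creation P) x).
Proof.
rewrite clpoly_eval_sum_gen -scalerN -sumrN scaler_sumr; apply: eq_bigr => j _.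
rewrite -[- (cl_gen R j * _)]mulrN cl_scaleAr; congr (_ * _); apply/ffunP => A.
rewrite [LHS]ffunE cl_scaleE [in RHS]ffunE clpoly_evalE.
have dP := is_derive_peval j (P A) x.
have [_] := is_deriveM (is_derive_gauss j x) dP.
have -> : (fun y => expR (- (sqnorm y / 2))) * peval (P A) =
    (fun y => (expR (- (sqnorm y / 2)) *: clpoly_eval P y) A).
  by apply/funext => y; rewrite cl_scaleE clpoly_evalE.
move=> ->.
rewrite !ffunE /peval mpoly.mevalB mpoly.mevalM mpoly.mevalXU /GRing.scale/=.
ring.
Qed.

Lemma creationN P : creation (- P) = - creation P.
Proof.
rewrite /creation -sumrN; apply: eq_bigr => j _; rewrite -mulrN; congr (_ * _).
by apply/ffunP => A; rewrite !ffunE mpoly.mderivN scalerN opprB opprK addrC.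
Qed.

Lemma iter_dirac_op_gauss l P x :
  iter l (@dirac_op R m)
    (fun y => expR (- (sqnorm y / 2)) *: clpoly_eval P y) x =
  (-1) ^+ l *: (expR (- (sqnorm x / 2)) *:
    clpoly_eval (iter l (@creation R m) P) x).
Proof.
have iterN n Q : iter n (@creation R m) (- Q) = - iter n (@creation R m) Q.
  by elim: n => //= n ->; rewrite creationN.
have evN Q y : clpoly_eval (- Q) y = - clpoly_eval Q y.
  by apply/ffunP => A; rewrite !ffunE mpoly.mevalN.
elim: l P => [|l IH] P; first by rewrite expr0 scale1r.
(* The innermost operator is peeled off, as it alone acts on a Gaussian times a polynomial; the
   induction hypothesis is then used at [- creation P]. *)
rewrite iterSr (_ : dirac_op _ =
    (fun y => expR (- (sqnorm y / 2)) *: clpoly_eval (- creation P) y)).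
  by rewrite IH iterN evN scalerN exprS -scalerA scaleN1r -iterSr scalerN.
by apply/funext => y; rewrite dirac_op_gauss evN scalerN.
Qed.

End Derivatives.

(** * The transform of a Gaussian times a polynomial *)

Section GaussianFunctional.
Variables (R : realType) (m : nat).
Local Notation mp := (mpoly.mpoly m R).
Local Notation T := (measurableTypeR R).
Local Notation nu := (lebesgue_tuple R m).
Local Notation row t := (@row_of_tuple R m t).
Implicit Types (p q : mp) (z : 'rV[R[i]]_m) (x : 'rV[R]_m).

(** Segal-Bargmann kernel times the weight e^(- |x|^2 / 4) of the transformed function: the two
    quarters make |x|^2 / 2. *)
Definition kernel z x : R[i] :=
  cexp (- (dot z z / 2) + dot (cplx_row x) z - ((sqnorm x / 2)%:C)%C).

Lemma kernel_prod z (t : m.-tuple T) :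
  kernel z (row t) = \prod_(j < m) gauss_kernel (z 0 j) (tnth t j).
Proof.
rewrite -cexp_sum; congr cexp.
rewrite !big_split/= !sumrN -!mulr_suml.
congr (_ + _ - _).
  by apply: eq_bigr => j _; rewrite !mxE.
rewrite -rmorph_sum/= -mulr_suml; congr ((_ / _)%:C)%C.
by apply: eq_bigr => j _; rewrite mxE expr2.
Qed.

Definition gauss_integrand z p (t : m.-tuple T) : R[i] :=
  kernel z (row t) * ((peval p (row t))%:C)%C.

Definition gauss_functional z p : R[i] :=
  (((Num.sqrt (2 * pi) ^+ m)^-1)%:C)%C *
  complex_integral nu (gauss_integrand z p).

Lemma gauss_integrandD z p q t :
  gauss_integrand z (p + q) t = gauss_integrand z p t + gauss_integrand z q t.
Proof. by rewrite /gauss_integrand /peval mpoly.mevalD rmorphD/= mulrDr. Qed.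

Lemma gauss_integrandZ z c p t :
  gauss_integrand z (c *: p) t = (c%:C)%C * gauss_integrand z p t.
Proof. by rewrite /gauss_integrand /peval mpoly.mevalZ rmorphM/= mulrCA. Qed.

Lemma gauss_integrandX z (a : mpoly.multinom m) :
  gauss_integrand z (mpoly.mpolyX R a) = (fun t => \prod_(j < m)
    (gauss_kernel (z 0 j) (tnth t j) * ((tnth t j ^+ a j)%:C)%C)).
Proof.
apply/funext => t; rewrite big_split/= /gauss_integrand kernel_prod.
congr (_ * _).
rewrite -rmorph_prod/= /peval mpoly.mevalX; congr ((_)%:C)%C.
by apply: eq_bigr => j _; rewrite mxE.
Qed.

Let tuple_moment z (a : mpoly.multinom m) :=
  complex_integral_tuple_prod (fun j => integrable_gauss_moment (z 0 j) (a j)).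

Lemma integrable_gauss_integrand z p :
  complex_integrable nu (gauss_integrand z p).
Proof.
elim/mpoly.mpolyind: p => [|c a p _ _ IH].
  (* The zero polynomial is treated as a multiple of the monomial 1, whose integrand is known to be
     integrable. *)
  have -> : gauss_integrand z 0 = (fun t => 0 * gauss_integrand z 1 t).
    apply/funext => t.
    by rewrite mul0r /gauss_integrand /peval mpoly.meval0 rmorph0 mulr0.
  apply: complex_integrableZ; rewrite -mpoly.mpolyX0 gauss_integrandX.
  exact: (tuple_moment z mpoly.mnm0).1.
have -> : gauss_integrand z (c *: mpoly.mpolyX R a + p) = (fun t =>
    (c%:C)%C * gauss_integrand z (mpoly.mpolyX R a) t + gauss_integrand z p t).
  by apply/funext => t; rewrite gauss_integrandD gauss_integrandZ.
apply: complex_integrableD => //; apply: complex_integrableZ.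
by rewrite gauss_integrandX; exact: (tuple_moment z a).1.
Qed.

Lemma gauss_functionalD z : {morph gauss_functional z : p q / p + q}.
Proof.
move=> p q; rewrite /gauss_functional -mulrDr -complex_integralD;
  try exact: integrable_gauss_integrand.
by congr (_ * complex_integral _ _); apply/funext => t; exact: gauss_integrandD.
Qed.

Lemma gauss_functionalZ z c p :
  gauss_functional z (c *: p) = (c%:C)%C * gauss_functional z p.
Proof.
rewrite /gauss_functional mulrCA;
  rewrite -[(c%:C)%C * complex_integral _ _]complex_integralZ;
  last exact: integrable_gauss_integrand.
by congr (_ * complex_integral _ _); apply/funext => t; exact: gauss_integrandZ.
Qed.

Lemma gauss_functionalB z : {morph gauss_functional z : p q / p - q}.
Proof.
move=> p q; rewrite gauss_functionalD -[- q]scaleN1r gauss_functionalZ.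
by rewrite rmorphN1 mulN1r.
Qed.

(** By its recurrence this is (-i)^n He_n(i w), with He_n the probabilists' Hermite polynomial. *)
Definition hermite_moment (w : R[i]) n : R[i] :=
  (((Num.sqrt (2 * pi))^-1)%:C)%C * gauss_moment w n.

Let sqrt2pi_neq0 : Num.sqrt (2 * pi) != 0 :> R.
Proof. by rewrite gt_eqF// sqrtr_gt0 mulr_gt0// pi_gt0. Qed.

Lemma hermite_moment0 w : hermite_moment w 0 = 1.
Proof. by rewrite /hermite_moment gauss_moment0 -rmorphM/= mulVf. Qed.

Lemma hermite_momentS w n : hermite_moment w n.+1 =
  w * hermite_moment w n + n%:R * hermite_moment w n.-1.
Proof.
by rewrite /hermite_moment gauss_momentS mulrDr !(mulrCA _ (_%:C)%C).
Qed.

Lemma gauss_functionalX z (a : mpoly.multinom m) :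
  gauss_functional z (mpoly.mpolyX R a) =
  \prod_(j < m) hermite_moment (z 0 j) (a j).
Proof.
rewrite /gauss_functional gauss_integrandX (tuple_moment z a).2 big_split/=.
by congr (_ * _); rewrite prodr_const card_ord -rmorphXn/= exprVn.
Qed.

Lemma gauss_functional1 z : gauss_functional z 1 = 1.
Proof.
rewrite -mpoly.mpolyX0 gauss_functionalX big1// => j _.
by rewrite mpoly.mnm0E hermite_moment0.
Qed.

(** On a monomial x^a, the three terms are products over the coordinates that differ in the j-th
    factor only, where the identity is [hermite_momentS] at n = a_j. If a_j = 0, the truncated
    exponent comes with coefficient 0. *)
Lemma gauss_functional_mvar z j p : gauss_functional z (mvar R j * p) =
  z 0 j * gauss_functional z p + gauss_functional z (mpoly.mderiv j p).
Proof.
elim/mpoly.mpolyind: p => [|c a p _ _ IH].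
  have g0 : gauss_functional z 0 = 0.
    by rewrite -[0 in LHS](subrr 0) gauss_functionalB subrr.
  by rewrite mulr0 mpoly.mderiv0 g0 mulr0 addr0.
rewrite mulrDr mpoly.mderivD !gauss_functionalD IH mulrDr addrACA.
congr (_ + _).
rewrite -scalerAr mpoly.mderivZ !gauss_functionalZ [z 0 j * (_ * _)]mulrCA.
rewrite -mulrDr; congr (_ * _).
rewrite mpoly.mderivX gauss_functionalZ /mvar -mpoly.mpolyXD !gauss_functionalX.
have E (b : mpoly.multinom m) : \prod_(i < m) hermite_moment (z 0 i) (b i) =
    hermite_moment (z 0 j) (b j) *
    \prod_(i < m | i != j) hermite_moment (z 0 i) (b i).
  by rewrite (bigD1 j).
rewrite !E mpoly.mnmDE mpoly.mnm1E eqxx hermite_momentS mulrDl.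
rewrite rmorph_nat -!mulrA mpoly.mnmBE mpoly.mnm1E eqxx subn1.
congr (_ * (_ * (_ * _)) + _ * (_ * (_ * _))); apply: eq_bigr => i ij.
  by rewrite mpoly.mnmDE mpoly.mnm1E eq_sym (negbTE ij).
by rewrite mpoly.mnmDE mpoly.mnmBE mpoly.mnm1E eq_sym (negbTE ij) subn0.
Qed.

Lemma measurable_peval p : measurable_fun [set: m.-tuple T]%classic
  (fun t : m.-tuple T => peval p (row t)).
Proof.
under eq_fun do rewrite /peval mpoly.mevalE.
apply: measurable_sum => a; apply: measurable_funM => //.
apply: measurable_prod => i _; apply: measurable_funX.
by under eq_fun do rewrite mxE; exact: measurable_tnth.
Qed.

(** The square of the function is the Gaussian integrand of p^2 at z = 0, already known to be
    integrable. *)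
Lemma gaussian_polynomial_L2 p :
  (fun t : m.-tuple T => expR (- (sqnorm (row t) / 4)) * peval p (row t)) \in
    Lfun nu 2%:E.
Proof.
set f := (fun t => _).
have fE t : f t ^+ 2 = complex.Re (gauss_integrand 0 (p * p) t).
  rewrite /gauss_integrand /kernel.
  have -> : - (dot (0 : 'rV[R[i]]_m) 0 / 2) + dot (cplx_row (row t)) 0 -
      ((sqnorm (row t) / 2)%:C)%C = ((- (sqnorm (row t) / 2))%:C)%C.
    have d0 (y : 'rV[R[i]]_m) : dot y 0 = 0.
      by rewrite /dot big1// => j _; rewrite !mxE mulr0.
    by rewrite !d0 mul0r oppr0 add0r sub0r rmorphN.
  rewrite cexp_real -rmorphM/= /f exprMn expr2 -expRD /peval mpoly.mevalM expr2.
  by congr (expR _ * _); field.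
have mf : measurable_fun [set: m.-tuple T]%classic f.
  apply: measurable_funM; last exact: measurable_peval.
  apply: measurableT_comp => //; apply: measurable_funN.
  apply: measurable_funM => //.
  by under eq_fun do rewrite -peval_sqnorm; exact: measurable_peval.
rewrite inE; apply/andP; split; rewrite inE//=.
rewrite /finite_norm unlock /Lnorm poweR_lty//.
have [/integrableP[_]] := integrable_gauss_integrand 0 (p * p).
move=> H _; apply: le_lt_trans H; rewrite le_eqVlt; apply/orP; left; apply/eqP.
apply: eq_integral => t _ /=.
by rewrite powR_mulrn// -normrX fE.
Qed.

End GaussianFunctional.

Section SegalBargmannTransform.
Variables (R : realType) (m : nat).
Implicit Types (P Q : clpoly R m) (z : 'rV[R[i]]_m).

Lemma segal_bargmann_gauss_poly Q z :
  segal_bargmann (fun x => expR (- (sqnorm x / 4)) *: clpoly_eval Q x) z =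
  cl_map (gauss_functional z) Q.
Proof.
apply/ffunP => A; rewrite cl_scaleE !ffunE; congr (_ * _).
suff E (t : m.-tuple (measurableTypeR R)) (x := row_of_tuple t) :
    (cexp (- (dot z z / 2) + dot (cplx_row x) z
       - dot (cplx_row x) (cplx_row x) / 4) *:
     cl_map (fun a : R => (a%:C)%C)
       (expR (- (sqnorm x / 4)) *: clpoly_eval Q x)) A =
    gauss_integrand z (Q A) t.
  by congr (_ +i* _)%C; apply: eq_Rintegral => t _; rewrite E.
rewrite cl_scaleE ffunE cl_scaleE clpoly_evalE rmorphM/= -cexp_real.
rewrite mulrA -cexpD.
congr (cexp _ * _); rewrite -[in RHS]addrA -[in LHS]addrA -[in LHS]addrA.
congr (_ + (_ + _)).
have -> : dot (cplx_row x) (cplx_row x) = ((sqnorm x)%:C)%C.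
  rewrite /sqnorm rmorph_sum; apply: eq_bigr => j _.
  by rewrite !mxE -rmorphM expr2.
have -> : (4 : R[i])^-1 = ((4^-1)%:C)%C by rewrite fmorphV rmorph_nat.
by rewrite -rmorphM -rmorphN -rmorphD -rmorphN/=; congr (_%:C)%C; field.
Qed.

(** The two signs (-1)^l and the exponentials of |x|^2 / 2 and - |x|^2 / 2 cancel, leaving (x - D)^l
    P. *)
Lemma clifford_hermite_mul l k P H : inner_spherical_monogenic k P ->
  clifford_hermite l k H -> forall x,
  clpoly_eval H x * clpoly_eval P x = clpoly_eval (iter l (@creation R m) P) x.
Proof.
move=> hP hH x; rewrite (hH P hP) iter_dirac_op_gauss.
rewrite [X in _ *: X]scalerA -exprMn mulrNN mulr1 expr1n scale1r.
by rewrite scalerA -expRD subrr expR0 scale1r.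
Qed.

Lemma gauss_functional_monogenic k P z : inner_spherical_monogenic k P ->
  cl_map (gauss_functional z) P = clpoly_evalC P z.
Proof.
move=> [hom mono]; apply/ffunP => A; rewrite !ffunE.
apply: (functional_harmonic (gauss_functionalB z) (@gauss_functionalZ _ _ z)
  (gauss_functional1 z) (gauss_functional_mvar z) (k := k)).
  move=> a; apply: contraNeq => ak.
  by rewrite (mpoly.dhomog_nemf_coeff (hom A) ak).
exact/harmonic_of_formal_dirac/formal_dirac_eq0.
Qed.

End SegalBargmannTransform.

Theorem theorem5p3 (R : realType) (m l k : nat) (P H : clpoly R m)
    (hm : (0 < m)%N)
    (hP : inner_spherical_monogenic k P)
    (hH : clifford_hermite l k H) :
  let f := fun x : 'rV[R]_m =>
    clpoly_eval H x * (expR (- (sqnorm x / 4)) *: clpoly_eval P x) in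
  in_L2 f /\
  forall z : 'rV[R[i]]_m,
    segal_bargmann f z = cl_vec z ^+ l * clpoly_evalC P z.
Proof.
move=> f; pose Q := iter l (@creation R m) P.
(* The weight is a real scalar, so it moves in front of the Clifford product and leaves H P = Q. *)
have -> : f = fun x => expR (- (sqnorm x / 4)) *: clpoly_eval Q x.
  by apply/funext => x; rewrite -(clifford_hermite_mul hP hH) cl_scaleAr.
split=> [A|z].
  under eq_fun do rewrite cl_scaleE clpoly_evalE.
  exact: gaussian_polynomial_L2.
rewrite segal_bargmann_gauss_poly (functional_iter_creation
  (gauss_functionalB z) (gauss_functional_mvar z)).
by rewrite (gauss_functional_monogenic z hP).
Qed.
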